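(* Let $\alpha>0$, $\eta\ge 0$, $\beta\in(0,1)$, $\delta\ge 0$. Consider, for $\lambda\in\mathbf{C}\setminus\{-1/\alpha\}$, the boundary-eigenvalue problem on $[0,1]$ consisting of $$(1+\alpha\lambda)w^{(4)}(\lambda,s)+\eta\,w^{(2)}(\lambda,s)+2\lambda\beta\eta^{1/2}\,w'(\lambda,s)+(\delta\lambda+\lambda^2)\,w(\lambda,s)=0$$ and the boundary conditions $$w^{(2)}(\lambda,0)-(k_{01}+\lambda k_{02})w'(\lambda,0)=0,\qquad w^{(3)}(\lambda,0)+(k_{03}+\lambda k_{04})w(\lambda,0)=0,$$ $$w^{(2)}(\lambda,1)+(k_{11}+\lambda k_{12})w'(\lambda,1)=0,\qquad w^{(3)}(\lambda,1)-(k_{13}+\lambda k_{14})w(\lambda,1)=0,$$ where either all $k_{0j},k_{1j}$, $j=1,2,3,4$, are positive and finite, or $k_{04}=k_{14}=0$ and the remaining parameters are positive and finite; or else the same differential equation with the clamped boundary conditions $w(\lambda,0)=w'(\lambda,0)=w(\lambda,1)=w'(\lambda,1)=0$. Let $\{\lambda_n\}$ be the sequence of eigenvalues of the problem in $\mathbf{C}\setminus\{-1/\alpha\}$. If $n$ is large enough, then $|\operatorname{Im}\lambda_n|/|\operatorname{Re}\lambda_n|\le 1$, and hence the eigenvalues lie in the sectorial set $$\left\{z\in\mathbf{C}\setminus\{-1/\alpha\}\;:\;|\operatorname{Im}(z-z_0)|\le r\,|\operatorname{Re}(z-z_0)|,\ \operatorname{Re}(z-z_0)\le 0\right\}$$ with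 certain positive constants $r$ and $z_0$, $r$ depending on the boundary parameters $k_{04},k_{14}$ and on $\alpha$, for all values of the other parameters. In particular, the only possible accumulation points of the eigenvalues in the extended complex plane are $-1/\alpha$ and infinity.
   Context: Primes and superscripts $(k)$ denote derivatives with respect to $s\in[0,1]$. An eigenvalue is a number $\lambda\in\mathbf{C}\setminus\{-1/\alpha\}$ for which the problem has a nontrivial solution $w(\lambda,\cdot)$. The index $n\to\infty$ corresponds to eigenvalues of large modulus, $|\lambda_n|\to\infty$. *)

(* Defs.v *)
From Stdlib Require Import Reals.
From Coquelicot Require Import Coquelicot.
Open Scope R_scope.

Definition unit_interval (s : R) : Prop := 0 <= s <= 1.

(* The derivative of f : [0,1] -> C at s, with C a real normed space. The
   increments are restricted to [0,1], so that the derivative is one-sided at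
   the endpoints and the values of f outside [0,1] are irrelevant. *)
Definition is_derive01 (f : R -> C) (s : R) (l : C) : Prop :=
  @filterdiff R_AbsRing R_NormedModule C_R_NormedModule
    f (within unit_interval (locally s)) (fun y : R => scal y l).

Definition derivative01 (f f' : R -> C) : Prop :=
  forall s, unit_interval s -> is_derive01 f s (f' s).

Record supports := Supports {
  k01 : R; k02 : R; k03 : R; k04 : R;
  k11 : R; k12 : R; k13 : R; k14 : R }.

Inductive boundary : Type :=
  | Elastic : supports -> boundary
  | Clamped : boundary.

Definition admissible_supports (k : supports) : Prop :=
  (0 < k01 k /\ 0 < k02 k /\ 0 < k03 k /\
   0 < k11 k /\ 0 < k12 k /\ 0 < k13 k) /\
  ((0 < k04 k /\ 0 < k14 k) \/ (k04 k = 0 /\ k14 k = 0)).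

Definition admissible (b : boundary) : Prop :=
  match b with
  | Elastic k => admissible_supports k
  | Clamped => True
  end.

(* The boundary parameters (k04, k14); the clamped problem has none. *)
Definition k_04_14 (b : boundary) : option (R * R) :=
  match b with
  | Elastic k => Some (k04 k, k14 k)
  | Clamped => None
  end.

Definition boundary_conditions (b : boundary) (lambda : C)
    (w w1 w2 w3 : R -> C) : Prop :=
  match b with
  | Elastic k =>
      (w2 0 - (k01 k + lambda * k02 k) * w1 0 = 0)%C /\
      (w3 0 + (k03 k + lambda * k04 k) * w 0 = 0)%C /\
      (w2 1 + (k11 k + lambda * k12 k) * w1 1 = 0)%C /\
      (w3 1 - (k13 k + lambda * k14 k) * w 1 = 0)%C
  | Clamped =>
      w 0 = 0%C /\ w1 0 = 0%C /\ w 1 = 0%C /\ w1 1 = 0%C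
  end.

Definition is_solution (alpha eta beta delta : R) (b : boundary) (lambda : C)
    (w : R -> C) : Prop :=
  exists w1 w2 w3 w4 : R -> C,
    derivative01 w w1 /\ derivative01 w1 w2 /\
    derivative01 w2 w3 /\ derivative01 w3 w4 /\
    (forall s, unit_interval s ->
      ((1 + alpha * lambda) * w4 s + eta * w2 s
       + 2 * lambda * beta * sqrt eta * w1 s
       + (delta * lambda + lambda * lambda) * w s = 0)%C) /\
    boundary_conditions b lambda w w1 w2 w3.

Definition is_eigenvalue (alpha eta beta delta : R) (b : boundary)
    (lambda : C) : Prop :=
  lambda <> RtoC (- 1 / alpha) /\
  exists w : R -> C,
    is_solution alpha eta beta delta b lambda w /\
    exists s, unit_interval s /\ w s <> 0%C.

Definition sectorial_set (alpha r z0 : R) (z : C) : Prop :=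
  z <> RtoC (- 1 / alpha) /\
  Rabs (Im (z - z0)%C) <= r * Rabs (Re (z - z0)%C) /\
  Re (z - z0)%C <= 0.

(* The extended complex plane, as the one-point compactification of C. *)
Inductive extC : Type :=
  | FinC : C -> extC
  | InfC : extC.

Definition neighbourhood (p : extC) (U : extC -> Prop) : Prop :=
  match p with
  | FinC z => locally z (fun x : C => U (FinC x))
  | InfC => U InfC /\ exists M : R, forall x : C, M < Cmod x -> U (FinC x)
  end.

Definition accumulation_point (S : C -> Prop) (p : extC) : Prop :=
  forall U, neighbourhood p U ->
    exists x : C, FinC x <> p /\ S x /\ U (FinC x).

(* Main.v *)
Require Import Defs.
From Stdlib Require Import Reals.
From Coquelicot Require Import Coquelicot.
From Stdlib Require Import Lra Lia Psatz Wf_nat Factorial Classical.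
Open Scope R_scope.

(** Two independent facts are combined.

    Location of the large eigenvalues ([eigenvalue_sector]).  Multiplying the
    equation by conj(w) and integrating by parts twice, one finds that an
    eigenvalue solves
      lambda^2 (M + alpha B1) + lambda (alpha E + B1 + delta M + g G)
        + E + eta H = 0,    g = 2 beta eta^(1/2),
    where M = |w|^2 in L2, E is the bending energy of w plus the elastic energy
    of its supports, B1 >= 0 comes from the damping in the supports, and G, H are
    the integrals of conj(w) against w' and w'' ([energy_identity]).  Were the
    terms G and H absent, this would be a quadratic equation with nonnegative
    coefficients, whose non-real roots are bounded because the middle
    coefficient is at least alpha E and the last one is E.  The terms G and H
    are absorbed: |H| <= (E + M) / 2, and |G| <= epsilon E + C M since the
    L2-norm of w' is controlled by E and M ([quadratic_sector]).  So
    |Im lambda| <= - Re lambda as soon as |lambda| exceeds some L.  The vertex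
    z0 = 2 L then puts all the eigenvalues into one sector of slope r = 1.

    Isolation of the eigenvalues away from -1/alpha ([eigenvalues_isolated]).
    Since the coefficients are constant in s, solutions are power series
    sum x_n s^n / n! with x_n given by a linear recurrence ([jet]), and
    lambda is an eigenvalue exactly when a 2 x 2 determinant vanishes
    ([eigenvalue_char_det]).  The coefficients of the recurrence are rational in
    lambda with their only pole at -1/alpha.  Around a given
    point z <> -1/alpha, the parameter
      1 + alpha lambda = (1 + alpha z) (1 + t) / (1 - t),    |t| < 1,
    describes a half plane that avoids the pole, and the determinant is an
    analytic function of t in the whole disc ([analytic_char_det]).
    If z were an accumulation point of eigenvalues, the determinant would vanish
    identically ([analytic_identity]); but the half plane contains points of
    large modulus outside the sector found before
    ([half_plane_escapes_sector]), and these are not eigenvalues.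

    Analyticity is handled through iterated difference quotients at 0 and
    Cauchy's estimates for them ([analytic]): products obey a Leibniz rule, and
    sums over n of difference quotients are formed pointwise, so that the
    analyticity of the determinant needs no interchange of summations. *)

(** * Calculus on the unit interval *)

Lemma norm_C_R (z : C) : @norm R_AbsRing C_R_NormedModule z = Cmod z.
Proof.
  unfold norm; simpl; unfold prod_norm, Cmod, norm; simpl; unfold abs; simpl.
  f_equal; rewrite <- !Rmult_assoc, !Rmult_1_r, <- !Rabs_mult, !Rabs_pos_eq;
    nra.
Qed.

Lemma Cmod_le_Re_Im (z : C) : Cmod z <= Rabs (Re z) + Rabs (Im z).
Proof.
  destruct z as [x y]; simpl.
  replace (x, y) with (RtoC x + Ci * RtoC y)%C
    by (unfold Cplus, Cmult, RtoC, Ci; simpl; f_equal; ring).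
  eapply Rle_trans; [apply Cmod_triangle|].
  rewrite Cmod_mult, Cmod_Ci, !Cmod_R; lra.
Qed.

Lemma im_le_Cmod (z : C) : Rabs (Im z) <= Cmod z.
Proof. exact (Rle_trans _ _ _ (Rmax_r _ _) (Rmax_Cmod z)). Qed.

Lemma is_derive01_eps (f : R -> C) (s : R) (l : C) :
  unit_interval s ->
  (is_derive01 f s l <->
   forall eps, 0 < eps -> exists d, 0 < d /\
     forall y, unit_interval y -> Rabs (y - s) < d ->
       Cmod (f y - f s - RtoC (y - s) * l)%C <= eps * Rabs (y - s)).
Proof.
  intros Hs.
  assert (E : forall y, minus (minus (f y) (f s))
              (@scal R_AbsRing C_R_NormedModule (minus y s) l)
              = (f y - f s - RtoC (y - s) * l)%C).
  { intros y; unfold minus, plus, opp, scal; simpl.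
    unfold prod_plus, prod_opp, prod_scal, plus, opp, scal; simpl.
    unfold mult; simpl.
    unfold Cminus, Cplus, Copp, Cmult, RtoC; simpl; f_equal; ring. }
  split.
  - intros [_ H] eps Heps.
    destruct (H s) with (eps := mkposreal eps Heps) as [d Hd].
    { intros P [e HP]; exists e; intros y Hy _; exact (HP y Hy). }
    exists d; split; [apply cond_pos|].
    intros y Hy Hys.
    rewrite <- norm_C_R, <- E; exact (Hd y Hys Hy).
  - intros H; split.
    + exact (@is_linear_scal_l R_AbsRing C_R_NormedModule l).
    + intros x Hx.
      assert (PF : ProperFilter' (within unit_interval (locally s))).
      { split; [|apply within_filter, locally_filter].
        intros [e He]; apply (He s (ball_center s e) Hs). }
      assert (x = s) as ->.
      { apply (@is_filter_lim_unique R_AbsRing R_NormedModule _ PF); trivial.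
        intros P [e HP]; exists e; intros y Hy _; exact (HP y Hy). }
      intros eps.
      destruct (H eps (cond_pos eps)) as [d [Hd HH]].
      exists (mkposreal d Hd); intros y Hy Hu.
      specialize (HH y Hu Hy).
      rewrite <- norm_C_R, <- E in HH; exact HH.
Qed.

(** A one-sided derivative is turned into a two-sided one by continuing the
    function affinely beyond each endpoint; this gives access to the
    mean value and the fundamental theorems on the closed interval. *)
Lemma affine_continuation (g g' : R -> R) :
  (forall s, unit_interval s -> forall eps, 0 < eps -> exists d, 0 < d /\
     forall y, unit_interval y -> Rabs (y - s) < d ->
       Rabs (g y - g s - (y - s) * g' s) <= eps * Rabs (y - s)) ->
  exists G : R -> R,
    forall s, unit_interval s -> G s = g s /\ is_derive G s (g' s).
Proof.
  intros H.
  set (G := fun y => if Rlt_dec y 0 then g 0 + y * g' 0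
                     else if Rlt_dec 1 y then g 1 + (y - 1) * g' 1 else g y).
  assert (G01 : forall y, unit_interval y -> G y = g y).
  { intros y [H0 H1]; unfold G; destruct (Rlt_dec y 0); [lra|].
    destruct (Rlt_dec 1 y); [lra|reflexivity]. }
  exists G; intros s Hs; split; [exact (G01 s Hs)|].
  apply is_derive_Reals; intros eps Heps.
  destruct (H s Hs (eps / 2)) as [d [Hd Hd']]; [lra|].
  (* The radius is small enough to exclude the endpoints different from s. *)
  assert (Hdm : 0 < (if Req_EM_T s 0 then 1 else s)
            /\ 0 < (if Req_EM_T s 1 then 1 else 1 - s)).
  { destruct Hs; destruct (Req_EM_T s 0), (Req_EM_T s 1); lra. }
  destruct Hdm as [Hd0 Hd1].
  set (d' := Rmin d (Rmin (if Req_EM_T s 0 then 1 else s)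
                          (if Req_EM_T s 1 then 1 else 1 - s))).
  assert (Hp : 0 < d') by (unfold d'; repeat apply Rmin_pos; assumption).
  exists (mkposreal d' Hp); simpl; intros h Hh Hhd.
  assert (A1 : Rabs h < d)
    by (eapply Rlt_le_trans; [exact Hhd|apply Rmin_l]).
  assert (A2 : Rabs h < (if Req_EM_T s 0 then 1 else s)).
  { eapply Rlt_le_trans; [exact Hhd|].
    eapply Rle_trans; [apply Rmin_r|apply Rmin_l]. }
  assert (A3 : Rabs h < (if Req_EM_T s 1 then 1 else 1 - s)).
  { eapply Rlt_le_trans; [exact Hhd|].
    eapply Rle_trans; [apply Rmin_r|apply Rmin_r]. }
  assert (K : Rabs (G (s + h) - G s - h * g' s) <= eps / 2 * Rabs h).
  { assert (Hz : 0 <= eps / 2 * Rabs h)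
      by (apply Rmult_le_pos; [lra|apply Rabs_pos]).
    rewrite (G01 s Hs).
    destruct (Rlt_dec (s + h) 0) as [L|L].
    - assert (s = 0) as ->.
      { destruct (Req_EM_T s 0); trivial.
        destruct Hs; apply Rabs_def2 in A2; lra. }
      unfold G; destruct (Rlt_dec (0 + h) 0); [|lra].
      replace (_ - _ - _) with 0 by ring; rewrite Rabs_R0; exact Hz.
    - destruct (Rlt_dec 1 (s + h)) as [L'|L'].
      + assert (s = 1) as ->.
        { destruct (Req_EM_T s 1); trivial.
          destruct Hs; apply Rabs_def2 in A3; lra. }
        unfold G; destruct (Rlt_dec (1 + h) 0); [lra|].
        destruct (Rlt_dec 1 (1 + h)); [|lra].
        replace (_ - _ - _) with 0 by ring; rewrite Rabs_R0; exact Hz.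
      + assert (Hu : unit_interval (s + h)) by (unfold unit_interval; lra).
        rewrite (G01 _ Hu).
        specialize (Hd' (s + h) Hu).
        replace (s + h - s) with h in Hd' by ring; auto. }
  replace ((G (s + h) - G s) / h - g' s)
    with ((G (s + h) - G s - h * g' s) / h) by (field; exact Hh).
  unfold Rdiv; rewrite Rabs_mult, Rabs_inv.
  assert (0 < Rabs h) by (apply Rabs_pos_lt; exact Hh).
  apply Rmult_lt_reg_r with (Rabs h); trivial.
  rewrite Rmult_assoc, Rinv_l, Rmult_1_r by lra; nra.
Qed.

Lemma derivative01_parts (f f' : R -> C) :
  derivative01 f f' ->
  exists u v : R -> R, forall s, unit_interval s ->
    f s = (u s, v s) /\ is_derive u s (Re (f' s)) /\ is_derive v s (Im (f' s)).
Proof.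
  intros H.
  assert (P : forall part : C -> R,
      (forall z, Rabs (part z) <= Cmod z) ->
      (forall (a b l : C) (x : R),
         part (a - b - RtoC x * l)%C = part a - part b - x * part l) ->
      exists G : R -> R, forall s, unit_interval s ->
        G s = part (f s) /\ is_derive G s (part (f' s))).
  { intros part Hle Hlin.
    apply (affine_continuation (fun s => part (f s)) (fun s => part (f' s))).
    intros s Hs eps Heps.
    destruct (proj1 (is_derive01_eps f s (f' s) Hs) (H s Hs) eps Heps)
      as [d [Hd Hd']].
    exists d; split; trivial; intros y Hy Hys.
    rewrite <- Hlin.
    exact (Rle_trans _ _ _ (Hle _) (Hd' y Hy Hys)). }
  destruct (P Re re_le_Cmod) as [u Hu].
  { intros [] [] [] x; simpl; ring. }
  destruct (P Im im_le_Cmod) as [v Hv].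
  { intros [] [] [] x; simpl; ring. }
  exists u, v; intros s Hs.
  destruct (Hu s Hs) as [E1 D1], (Hv s Hs) as [E2 D2].
  rewrite E1, E2; destruct (f s); simpl; auto.
Qed.

Lemma is_derive_eps (g : R -> R) (s l : R) :
  is_derive g s l -> forall eps, 0 < eps -> exists d, 0 < d /\
    forall y, Rabs (y - s) < d ->
      Rabs (g y - g s - (y - s) * l) <= eps * Rabs (y - s).
Proof.
  intros [_ H] eps Heps.
  destruct (H s (fun P HP => HP) (mkposreal eps Heps)) as [d Hd].
  exists d; split; [apply cond_pos|exact Hd].
Qed.

Lemma derivative01_of_parts (f f' : R -> C) :
  (forall s, unit_interval s ->
     is_derive (fun y => Re (f y)) s (Re (f' s)) /\
     is_derive (fun y => Im (f y)) s (Im (f' s))) ->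
  derivative01 f f'.
Proof.
  intros H s Hs; apply is_derive01_eps; trivial.
  intros eps Heps; destruct (H s Hs) as [D1 D2].
  assert (He : 0 < eps / 2) by lra.
  destruct (is_derive_eps _ _ _ D1 _ He) as [d1 [P1 Q1]].
  destruct (is_derive_eps _ _ _ D2 _ He) as [d2 [P2 Q2]].
  exists (Rmin d1 d2); split; [apply Rmin_pos; trivial|].
  intros y _ Hy.
  specialize (Q1 y (Rlt_le_trans _ _ _ Hy (Rmin_l _ _))).
  specialize (Q2 y (Rlt_le_trans _ _ _ Hy (Rmin_r _ _))).
  eapply Rle_trans; [apply Cmod_le_Re_Im|].
  replace (Re (f y - f s - RtoC (y - s) * f' s)%C)
    with (Re (f y) - Re (f s) - (y - s) * Re (f' s))
    by (destruct (f y), (f s), (f' s); simpl; ring).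
  replace (Im (f y - f s - RtoC (y - s) * f' s)%C)
    with (Im (f y) - Im (f s) - (y - s) * Im (f' s))
    by (destruct (f y), (f s), (f' s); simpl; ring).
  lra.
Qed.

(** * The energy identity *)

Definition derivable01 (f : R -> R) : Prop :=
  forall s, unit_interval s -> ex_derive f s.

Lemma derivable01_continuous (f : R -> R) (s : R) :
  derivable01 f -> Rmin 0 1 <= s <= Rmax 0 1 -> continuous f s.
Proof.
  rewrite Rmin_left, Rmax_right by lra; intros H Hs.
  exact (ex_derive_continuous f s (H s Hs)).
Qed.

Lemma derivable01_ex_RInt (f : R -> R) : derivable01 f -> ex_RInt f 0 1.
Proof.
  intros H; apply (@ex_RInt_continuous R_CompleteNormedModule).
  intros s Hs; exact (derivable01_continuous f s H Hs).
Qed.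

Lemma RInt01_lin (c : R) (f g : R -> R) :
  derivable01 f -> derivable01 g ->
  RInt (fun s => c * f s + g s) 0 1 = c * RInt f 0 1 + RInt g 0 1.
Proof.
  intros Hf Hg.
  apply (@is_RInt_unique R_CompleteNormedModule).
  apply (@is_RInt_plus R_NormedModule (fun s => c * f s) g).
  - apply (@is_RInt_scal R_NormedModule f).
    exact (@RInt_correct R_CompleteNormedModule _ _ _ (derivable01_ex_RInt f Hf)).
  - exact (@RInt_correct R_CompleteNormedModule _ _ _ (derivable01_ex_RInt g Hg)).
Qed.

Lemma derivable01_lin (c : R) (f g : R -> R) :
  derivable01 f -> derivable01 g -> derivable01 (fun s => c * f s + g s).
Proof. intros Hf Hg s Hs; auto_derive; repeat split; auto. Qed.

Lemma derivable01_zero : derivable01 (fun _ => 0).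
Proof. intros s Hs; auto_derive; trivial. Qed.

Lemma RInt01_zero : RInt (fun _ => 0) 0 1 = 0.
Proof.
  rewrite (@RInt_const R_CompleteNormedModule).
  unfold scal; simpl; unfold mult; simpl; ring.
Qed.

#[local] Hint Resolve derivable01_lin derivable01_zero : core.

Lemma RInt01_derive (F f : R -> R) :
  derivable01 f -> (forall s, unit_interval s -> is_derive F s (f s)) ->
  RInt f 0 1 = F 1 - F 0.
Proof.
  intros Hf HF.
  apply (@is_RInt_unique R_CompleteNormedModule).
  apply (@is_RInt_derive R_CompleteNormedModule F f).
  - rewrite Rmin_left, Rmax_right by lra; exact HF.
  - intros s Hs; exact (derivable01_continuous f s Hf Hs).
Qed.

Lemma RInt01_le (f g : R -> R) :
  derivable01 f -> derivable01 g -> (forall s, f s <= g s) ->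
  RInt f 0 1 <= RInt g 0 1.
Proof.
  intros Hf Hg H; apply RInt_le; [lra|..]; auto using derivable01_ex_RInt.
Qed.

Lemma RInt01_pos (f : R -> R) (s : R) :
  derivable01 f -> (forall t, 0 <= f t) -> unit_interval s -> 0 < f s ->
  0 < RInt f 0 1.
Proof.
  intros Hf H0 Hs Hp.
  assert (Hc : continuity_pt f s)
    by (apply continuity_pt_filterlim; apply (ex_derive_continuous f s (Hf s Hs))).
  destruct (Hc (f s) Hp) as [d [Hd Hd']].
  assert (Hpos : forall t, Rabs (t - s) < d -> 0 < f t).
  { intros t Ht; destruct (Req_dec t s) as [->|Hne]; trivial.
    specialize (Hd' t); unfold D_x, no_cond, dist in Hd'; simpl in Hd'.
    unfold Rdist in Hd'.
    assert (K : Rabs (f t - f s) < f s)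
      by (apply Hd'; repeat split; auto).
    apply Rabs_def2 in K; lra. }
  set (p := Rmax 0 (s - d / 2)); set (q := Rmin 1 (s + d / 2)).
  assert (Hpq : 0 <= p /\ p < q /\ q <= 1 /\ s - d / 2 <= p /\ q <= s + d / 2).
  { destruct Hs; unfold p, q, Rmax, Rmin.
    destruct (Rle_dec 0 (s - d / 2)), (Rle_dec 1 (s + d / 2)); lra. }
  destruct Hpq as (P0 & P1 & P2 & P3 & P4).
  assert (Hex : forall x y, 0 <= x -> x <= y -> y <= 1 -> ex_RInt f x y).
  { intros x y Hx Hxy Hy; apply (@ex_RInt_continuous R_CompleteNormedModule).
    rewrite Rmin_left, Rmax_right by lra; intros z Hz.
    apply (ex_derive_continuous f z); apply Hf; split; lra. }
  assert (C1 : RInt f 0 p + RInt f p 1 = RInt f 0 1)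
    by (apply (@RInt_Chasles R_CompleteNormedModule f); apply Hex; lra).
  assert (C2 : RInt f p q + RInt f q 1 = RInt f p 1)
    by (apply (@RInt_Chasles R_CompleteNormedModule f); apply Hex; lra).
  assert (0 <= RInt f 0 p) by (apply RInt_ge_0; auto; apply Hex; lra).
  assert (0 <= RInt f q 1) by (apply RInt_ge_0; auto; apply Hex; lra).
  assert (0 < RInt f p q).
  { apply RInt_gt_0; trivial.
    - intros t Ht; apply Hpos; apply Rabs_def1; lra.
    - intros t Ht; apply (ex_derive_continuous f t); apply Hf; split; lra. }
  lra.
Qed.

Ltac derivable :=
  repeat split; trivial;
  match goal with
  | H : forall s, unit_interval s -> is_derive ?f s _, Hs : unit_interval ?s
    |- ex_derive (fun t => ?f t) ?s => exact (ex_intro _ _ (H s Hs))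
  end.

Ltac derivable01_tac :=
  match goal with |- derivable01 ?f => try unfold f end;
  intros ? ?; auto_derive; derivable.

Ltac derive_with s Hs :=
  auto_derive;
  [ derivable
  | repeat match goal with
    | H : forall s, unit_interval s -> is_derive ?f s (?f' s) |- _ =>
        let E := fresh in
        assert (E : Derive (fun t => f t) s = f' s)
          by exact (is_derive_unique _ _ _ (H s Hs));
        rewrite ?E; clear E H
    end ].

(** Integration by parts for w = u0 + i v0 with successive derivatives
    u1 + i v1, ..., u4 + i v4.  Here g stands for 2 beta eta^(1/2),
    m1 + i m2 for 1 + alpha lambda, x + i y for lambda and r1 + i r2 for
    delta lambda + lambda^2; the boundary terms of the product of the fourth
    derivative with conj(w) are collected in q1 + i q2. *)
Lemma integrated_equation (u0 u1 u2 u3 u4 v0 v1 v2 v3 v4 : R -> R)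
  (m1 m2 eta g x y r1 r2 : R) :
  (forall s, unit_interval s -> is_derive u0 s (u1 s)) ->
  (forall s, unit_interval s -> is_derive u1 s (u2 s)) ->
  (forall s, unit_interval s -> is_derive u2 s (u3 s)) ->
  (forall s, unit_interval s -> is_derive u3 s (u4 s)) ->
  (forall s, unit_interval s -> is_derive v0 s (v1 s)) ->
  (forall s, unit_interval s -> is_derive v1 s (v2 s)) ->
  (forall s, unit_interval s -> is_derive v2 s (v3 s)) ->
  (forall s, unit_interval s -> is_derive v3 s (v4 s)) ->
  (forall s, unit_interval s ->
     m1 * u4 s - m2 * v4 s + eta * u2 s + g * (x * u1 s - y * v1 s)
     + (r1 * u0 s - r2 * v0 s) = 0) ->
  (forall s, unit_interval s ->
     m1 * v4 s + m2 * u4 s + eta * v2 s + g * (x * v1 s + y * u1 s)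
     + (r1 * v0 s + r2 * u0 s) = 0) ->
  let I (f : R -> R) : R := RInt f 0 1 in
  let q1 s := u3 s * u0 s + v3 s * v0 s - (u2 s * u1 s + v2 s * v1 s) in
  let q2 s := v3 s * u0 s - u3 s * v0 s - (v2 s * u1 s - u2 s * v1 s) in
  let a s := u2 s ^ 2 + v2 s ^ 2 in
  let d s := u1 s ^ 2 + v1 s ^ 2 in
  let m s := u0 s ^ 2 + v0 s ^ 2 in
  let g1 s := u1 s * u0 s + v1 s * v0 s in
  let g2 s := v1 s * u0 s - u1 s * v0 s in
  let h1 s := u2 s * u0 s + v2 s * v0 s in
  let h2 s := v2 s * u0 s - u2 s * v0 s in
  m1 * (q1 1 - q1 0) - m2 * (q2 1 - q2 0) + m1 * I a + eta * I h1
    + g * (x * I g1 - y * I g2) + r1 * I m = 0 /\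
  m2 * (q1 1 - q1 0) + m1 * (q2 1 - q2 0) + m2 * I a + eta * I h2
    + g * (x * I g2 + y * I g1) + r2 * I m = 0 /\
  I d = g1 1 - g1 0 - I h1.
Proof.
  intros Du0 Du1 Du2 Du3 Dv0 Dv1 Dv2 Dv3 E1 E2 I q1 q2 a d m g1 g2 h1 h2.
  assert (Sa : derivable01 a) by derivable01_tac.
  assert (Sd : derivable01 d) by derivable01_tac.
  assert (Sm : derivable01 m) by derivable01_tac.
  assert (Sg1 : derivable01 g1) by derivable01_tac.
  assert (Sg2 : derivable01 g2) by derivable01_tac.
  assert (Sh1 : derivable01 h1) by derivable01_tac.
  assert (Sh2 : derivable01 h2) by derivable01_tac.
  repeat split.
  - assert (K := RInt01_derive (fun s => m1 * q1 s - m2 * q2 s)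
      (fun s => - m1 * a s + (- eta * h1 s + (- (g * x) * g1 s
                + (g * y * g2 s + (- r1 * m s + 0)))))).
    rewrite !RInt01_lin, RInt01_zero in K by auto 10.
    fold (I a) (I h1) (I g1) (I g2) (I m) in K.
    cut (- m1 * I a + (- eta * I h1 + (- (g * x) * I g1
           + (g * y * I g2 + (- r1 * I m + 0))))
         = m1 * q1 1 - m2 * q2 1 - (m1 * q1 0 - m2 * q2 0)); [lra|].
    apply K; [auto 10|]; intros s Hs; unfold q1, q2.
    specialize (E1 s Hs); specialize (E2 s Hs).
    derive_with s Hs.
    match type of E1 with ?e1 = 0 => match type of E2 with ?e2 = 0 =>
      apply Rminus_diag_uniq; transitivity (u0 s * e1 + v0 s * e2);
      [unfold a, h1, g1, g2, m; ring|rewrite E1, E2; ring] end end.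
  - assert (K := RInt01_derive (fun s => m2 * q1 s + m1 * q2 s)
      (fun s => - m2 * a s + (- eta * h2 s + (- (g * x) * g2 s
                + (- (g * y) * g1 s + (- r2 * m s + 0)))))).
    rewrite !RInt01_lin, RInt01_zero in K by auto 10.
    fold (I a) (I h2) (I g1) (I g2) (I m) in K.
    cut (- m2 * I a + (- eta * I h2 + (- (g * x) * I g2
           + (- (g * y) * I g1 + (- r2 * I m + 0))))
         = m2 * q1 1 + m1 * q2 1 - (m2 * q1 0 + m1 * q2 0)); [lra|].
    apply K; [auto 10|]; intros s Hs; unfold q1, q2.
    specialize (E1 s Hs); specialize (E2 s Hs).
    derive_with s Hs.
    match type of E1 with ?e1 = 0 => match type of E2 with ?e2 = 0 =>
      apply Rminus_diag_uniq; transitivity (u0 s * e2 - v0 s * e1);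
      [unfold a, h2, g1, g2, m; ring|rewrite E1, E2; ring] end end.
  - assert (K := RInt01_derive g1 (fun s => 1 * h1 s + d s)).
    rewrite RInt01_lin in K by auto.
    fold (I h1) (I d) in K.
    cut (1 * I h1 + I d = g1 1 - g1 0); [lra|].
    apply K; [auto|]; intros s Hs; unfold g1.
    derive_with s Hs.
    unfold h1, d; ring.
Qed.

(** Weighted form of the Cauchy-Schwarz inequality. *)
Lemma RInt01_abs_le (f a m : R -> R) (e : R) :
  derivable01 f -> derivable01 a -> derivable01 m -> 0 < e ->
  (forall s, 2 * Rabs (f s) <= e * a s + / e * m s) ->
  2 * Rabs (RInt f 0 1) <= e * RInt a 0 1 + / e * RInt m 0 1.
Proof.
  intros Sf Sa Sm He H.
  assert (K : forall c, Rabs c = 2 ->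
    c * RInt f 0 1 <= e * RInt a 0 1 + / e * RInt m 0 1).
  { intros c Hc.
    assert (L := RInt01_le (fun s => c * f s + 0)
                   (fun s => e * a s + (/ e * m s + 0))).
    rewrite !RInt01_lin, RInt01_zero in L by auto.
    cut (c * RInt f 0 1 + 0 <= e * RInt a 0 1 + (/ e * RInt m 0 1 + 0)); [lra|].
    apply L; auto; intros s.
    specialize (H s); rewrite <- Hc, <- Rabs_mult in H.
    assert (X := Rle_abs (c * f s)); lra. }
  assert (K1 := K 2 (Rabs_pos_eq 2 ltac:(lra))).
  assert (K2 := K (-2) ltac:(rewrite Rabs_left; lra)).
  unfold Rabs; destruct (Rcase_abs _); lra.
Qed.

Lemma two_abs_dot_le (p q u v e : R) : 0 < e ->
  2 * Rabs (p * u + q * v) <= e * (p ^ 2 + q ^ 2) + / e * (u ^ 2 + v ^ 2).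
Proof.
  intros He.
  assert (Hk : e * / e = 1) by (apply Rinv_r; lra).
  assert (K : forall c, c * c = 1 ->
    2 * (c * (p * u + q * v)) <= e * (p ^ 2 + q ^ 2) + / e * (u ^ 2 + v ^ 2)).
  { intros c Hc.
    assert (0 <= e * ((p - c * (/ e * u)) ^ 2 + (q - c * (/ e * v)) ^ 2)).
    { apply Rmult_le_pos; [lra|]; apply Rplus_le_le_0_compat; apply pow2_ge_0. }
    replace (e * _) with (e * (p ^ 2 + q ^ 2)
      - 2 * ((e * / e) * (c * (p * u + q * v)))
      + (c * c) * (e * / e) * (/ e * (u ^ 2 + v ^ 2))) in H by ring.
    rewrite Hk, Hc in H; lra. }
  assert (K1 := K 1 ltac:(ring)); assert (K2 := K (-1) ltac:(ring)).
  unfold Rabs; destruct (Rcase_abs _); lra.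
Qed.

Definition trace_constant (b : boundary) : R :=
  match b with
  | Elastic k => / k01 k + / k03 k + / k11 k + / k13 k
  | Clamped => 0
  end.

(** The supports are dissipative: the boundary terms of the integration by
    parts are B0 + lambda B1 with nonnegative B0 and B1, and the elastic energy B0
    stored in the supports controls the boundary terms of lower order. *)
Lemma boundary_energy (b : boundary) (x y : R)
  (u0 u1 u2 u3 v0 v1 v2 v3 : R -> R) :
  admissible b ->
  boundary_conditions b (x, y) (fun s => (u0 s, v0 s)) (fun s => (u1 s, v1 s))
    (fun s => (u2 s, v2 s)) (fun s => (u3 s, v3 s)) ->
  let q1 s := u3 s * u0 s + v3 s * v0 s - (u2 s * u1 s + v2 s * v1 s) in
  let q2 s := v3 s * u0 s - u3 s * v0 s - (v2 s * u1 s - u2 s * v1 s) in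
  let g1 s := u1 s * u0 s + v1 s * v0 s in
  exists B0 B1, 0 <= B0 /\ 0 <= B1 /\
    q1 1 - q1 0 = B0 + x * B1 /\ q2 1 - q2 0 = y * B1 /\
    g1 1 - g1 0 <= trace_constant b * B0.
Proof.
  intros Hb HB q1 q2 g1.
  destruct b as [k|].
  - destruct HB as (E1 & E2 & E3 & E4).
    destruct Hb as [(P1 & P2 & P3 & P4 & P5 & P6) P7].
    assert (P8 : 0 <= k04 k /\ 0 <= k14 k) by lra.
    assert (F1 := f_equal Re E1); assert (F1' := f_equal Im E1).
    assert (F2 := f_equal Re E2); assert (F2' := f_equal Im E2).
    assert (F3 := f_equal Re E3); assert (F3' := f_equal Im E3).
    assert (F4 := f_equal Re E4); assert (F4' := f_equal Im E4).
    simpl in F1, F1', F2, F2', F3, F3', F4, F4'.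
    set (W0 := u0 0 ^ 2 + v0 0 ^ 2); set (W1 := u0 1 ^ 2 + v0 1 ^ 2).
    set (D0 := u1 0 ^ 2 + v1 0 ^ 2); set (D1 := u1 1 ^ 2 + v1 1 ^ 2).
    assert (0 <= W0 /\ 0 <= W1 /\ 0 <= D0 /\ 0 <= D1)
      as (HW0 & HW1 & HD0 & HD1) by (unfold W0, W1, D0, D1; repeat split; nra).
    assert (Q1 := Rmult_le_pos _ _ (Rlt_le _ _ P1) HD0).
    assert (Q2 := Rmult_le_pos _ _ (Rlt_le _ _ P2) HD0).
    assert (Q3 := Rmult_le_pos _ _ (Rlt_le _ _ P3) HW0).
    assert (Q4 := Rmult_le_pos _ _ (proj1 P8) HW0).
    assert (Q5 := Rmult_le_pos _ _ (Rlt_le _ _ P4) HD1).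
    assert (Q6 := Rmult_le_pos _ _ (Rlt_le _ _ P5) HD1).
    assert (Q7 := Rmult_le_pos _ _ (Rlt_le _ _ P6) HW1).
    assert (Q8 := Rmult_le_pos _ _ (proj2 P8) HW1).
    exists (k01 k * D0 + k03 k * W0 + k11 k * D1 + k13 k * W1),
           (k02 k * D0 + k04 k * W0 + k12 k * D1 + k14 k * W1).
    split; [lra|]; split; [lra|].
    assert (T1 : u2 0 = (k01 k + x * k02 k) * u1 0 - y * k02 k * v1 0) by lra.
    assert (T1' : v2 0 = (k01 k + x * k02 k) * v1 0 + y * k02 k * u1 0) by lra.
    assert (T2 : u3 0 = - ((k03 k + x * k04 k) * u0 0 - y * k04 k * v0 0)) by lra.
    assert (T2' : v3 0 = - ((k03 k + x * k04 k) * v0 0 + y * k04 k * u0 0)) by lra.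
    assert (T3 : u2 1 = - ((k11 k + x * k12 k) * u1 1 - y * k12 k * v1 1)) by lra.
    assert (T3' : v2 1 = - ((k11 k + x * k12 k) * v1 1 + y * k12 k * u1 1)) by lra.
    assert (T4 : u3 1 = (k13 k + x * k14 k) * u0 1 - y * k14 k * v0 1) by lra.
    assert (T4' : v3 1 = (k13 k + x * k14 k) * v0 1 + y * k14 k * u0 1) by lra.
    split; [|split].
    + unfold q1; rewrite T1, T1', T2, T2', T3, T3', T4, T4'.
      unfold W0, W1, D0, D1; ring.
    + unfold q2; rewrite T1, T1', T2, T2', T3, T3', T4, T4'.
      unfold W0, W1, D0, D1; ring.
    + assert (J1 := Rinv_0_lt_compat _ P1); assert (J3 := Rinv_0_lt_compat _ P3).
      assert (J4 := Rinv_0_lt_compat _ P4); assert (J6 := Rinv_0_lt_compat _ P6).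
      assert (N1 : / k01 k * (k01 k * D0) = D0) by (field; lra).
      assert (N3 : / k03 k * (k03 k * W0) = W0) by (field; lra).
      assert (N4 : / k11 k * (k11 k * D1) = D1) by (field; lra).
      assert (N6 : / k13 k * (k13 k * W1) = W1) by (field; lra).
      assert (D0 + W0 + D1 + W1 <= trace_constant (Elastic k)
        * (k01 k * D0 + k03 k * W0 + k11 k * D1 + k13 k * W1)).
      { simpl.
        set (i1 := / k01 k) in *; set (i3 := / k03 k) in *;
        set (i4 := / k11 k) in *; set (i6 := / k13 k) in *.
        set (e1 := k01 k * D0) in *; set (e3 := k03 k * W0) in *;
        set (e4 := k11 k * D1) in *; set (e6 := k13 k * W1) in *.
        assert (M : forall i e, 0 < i -> 0 <= e -> 0 <= i * e)
          by (intros; apply Rmult_le_pos; lra).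
        assert (M13 := M i1 e3 J1 Q3); assert (M14 := M i1 e4 J1 Q5).
        assert (M16 := M i1 e6 J1 Q7); assert (M31 := M i3 e1 J3 Q1).
        assert (M34 := M i3 e4 J3 Q5); assert (M36 := M i3 e6 J3 Q7).
        assert (M41 := M i4 e1 J4 Q1); assert (M43 := M i4 e3 J4 Q3).
        assert (M46 := M i4 e6 J4 Q7); assert (M61 := M i6 e1 J6 Q1).
        assert (M63 := M i6 e3 J6 Q3); assert (M64 := M i6 e4 J6 Q5).
        replace ((i1 + i3 + i4 + i6) * (e1 + e3 + e4 + e6)) with
          (i1 * e1 + i3 * e3 + i4 * e4 + i6 * e6 + i1 * e3 + i1 * e4 + i1 * e6
           + i3 * e1 + i3 * e4 + i3 * e6 + i4 * e1 + i4 * e3 + i4 * e6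
           + i6 * e1 + i6 * e3 + i6 * e4) by ring.
        lra. }
      assert (g1 1 - g1 0 <= D0 + W0 + D1 + W1); [|lra].
      assert (S1 := two_abs_dot_le (u1 1) (v1 1) (u0 1) (v0 1) 1 ltac:(lra)).
      assert (S0 := two_abs_dot_le (u1 0) (v1 0) (u0 0) (v0 0) 1 ltac:(lra)).
      rewrite Rinv_1 in S0, S1.
      assert (A1 := Rle_abs (g1 1)); assert (A0 := Rle_abs (- g1 0)).
      rewrite Rabs_Ropp in A0.
      fold (g1 1) in S1; fold (g1 0) in S0; fold D1 W1 in S1; fold D0 W0 in S0.
      lra.
  - destruct HB as (E1 & E2 & E3 & E4).
    injection E1 as F1 F1'; injection E2 as F2 F2';
    injection E3 as F3 F3'; injection E4 as F4 F4'.
    exists 0, 0; simpl; unfold q1, q2, g1.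
    rewrite F1, F1', F2, F2', F3, F3', F4, F4'; repeat split; lra.
Qed.

(** The quadratic equation satisfied by an eigenvalue, with coefficients
    depending on the eigenfunction: A, D and M are the squared L2-norms of
    w'', w' and w, and G1 + i G2, H1 + i H2 are the integrals of conj(w)
    against w' and w''. *)
Lemma energy_identity (alpha eta beta delta : R) (b : boundary) (lambda : C) :
  admissible b -> is_eigenvalue alpha eta beta delta b lambda ->
  exists A M B0 B1 D G1 G2 H1 H2,
    (0 <= A /\ 0 < M /\ 0 <= B0 /\ 0 <= B1) /\
    D <= trace_constant b * B0 + (A + M) / 2 /\
    2 * Rabs H1 <= A + M /\ 2 * Rabs H2 <= A + M /\
    (forall e, 0 < e ->
       2 * Rabs G1 <= e * D + / e * M /\ 2 * Rabs G2 <= e * D + / e * M) /\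
    let x := Re lambda in let y := Im lambda in let g := 2 * beta * sqrt eta in
    (1 + alpha * x) * (A + B0 + x * B1) - alpha * y * (y * B1)
      + eta * H1 + g * (x * G1 - y * G2)
      + (delta * x + (x ^ 2 - y ^ 2)) * M = 0 /\
    alpha * y * (A + B0 + x * B1) + (1 + alpha * x) * (y * B1)
      + eta * H2 + g * (x * G2 + y * G1) + (delta * y + 2 * x * y) * M = 0.
Proof.
  intros Hb (_ & w & (w1 & w2 & w3 & w4 & D0 & D1 & D2 & D3 & Eq & HB) & s0 & Hs0 & Hw).
  destruct (derivative01_parts _ _ D0) as (u0 & v0 & P0).
  destruct (derivative01_parts _ _ D1) as (u1 & v1 & P1).
  destruct (derivative01_parts _ _ D2) as (u2 & v2 & P2).
  destruct (derivative01_parts _ _ D3) as (u3 & v3 & P3).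
  assert (C0 : forall s, unit_interval s -> w s = (u0 s, v0 s)) by apply P0.
  assert (C1 : forall s, unit_interval s -> w1 s = (u1 s, v1 s)) by apply P1.
  assert (C2 : forall s, unit_interval s -> w2 s = (u2 s, v2 s)) by apply P2.
  assert (C3 : forall s, unit_interval s -> w3 s = (u3 s, v3 s)) by apply P3.
  assert (Du0 : forall s, unit_interval s -> is_derive u0 s (u1 s)).
  { intros s Hs; destruct (P0 s Hs) as (_ & K & _); rewrite C1 in K; trivial. }
  assert (Du1 : forall s, unit_interval s -> is_derive u1 s (u2 s)).
  { intros s Hs; destruct (P1 s Hs) as (_ & K & _); rewrite C2 in K; trivial. }
  assert (Du2 : forall s, unit_interval s -> is_derive u2 s (u3 s)).
  { intros s Hs; destruct (P2 s Hs) as (_ & K & _); rewrite C3 in K; trivial. }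
  assert (Du3 : forall s, unit_interval s -> is_derive u3 s (Re (w4 s))) by apply P3.
  assert (Dv0 : forall s, unit_interval s -> is_derive v0 s (v1 s)).
  { intros s Hs; destruct (P0 s Hs) as (_ & _ & K); rewrite C1 in K; trivial. }
  assert (Dv1 : forall s, unit_interval s -> is_derive v1 s (v2 s)).
  { intros s Hs; destruct (P1 s Hs) as (_ & _ & K); rewrite C2 in K; trivial. }
  assert (Dv2 : forall s, unit_interval s -> is_derive v2 s (v3 s)).
  { intros s Hs; destruct (P2 s Hs) as (_ & _ & K); rewrite C3 in K; trivial. }
  assert (Dv3 : forall s, unit_interval s -> is_derive v3 s (Im (w4 s))) by apply P3.
  destruct lambda as [x y].
  set (g := 2 * beta * sqrt eta).
  assert (Eq1 := integrated_equation u0 u1 u2 u3 (fun s => Re (w4 s))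
    v0 v1 v2 v3 (fun s => Im (w4 s)) (1 + alpha * x) (alpha * y) eta g x y
    (delta * x + (x ^ 2 - y ^ 2)) (delta * y + 2 * x * y)
    Du0 Du1 Du2 Du3 Dv0 Dv1 Dv2 Dv3).
  destruct Eq1 as (I1 & I2 & I3).
  { intros s Hs; specialize (Eq s Hs); rewrite C0, C1, C2 in Eq by trivial.
    apply (f_equal Re) in Eq; destruct (w4 s); simpl in *; unfold g; lra. }
  { intros s Hs; specialize (Eq s Hs); rewrite C0, C1, C2 in Eq by trivial.
    apply (f_equal Im) in Eq; destruct (w4 s); simpl in *; unfold g; lra. }
  assert (BC : boundary_conditions b (x, y) (fun s => (u0 s, v0 s))
    (fun s => (u1 s, v1 s)) (fun s => (u2 s, v2 s)) (fun s => (u3 s, v3 s))).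
  { assert (U0 : unit_interval 0) by (split; lra).
    assert (U1 : unit_interval 1) by (split; lra).
    destruct b; simpl in *; rewrite !C0, !C1, ?C2, ?C3 in HB by trivial; exact HB. }
  destruct (boundary_energy b x y _ _ _ _ _ _ _ _ Hb BC)
    as (B0 & B1 & PB0 & PB1 & Q1 & Q2 & Q3).
  rewrite Q1, Q2 in I1, I2.
  set (a := fun s => u2 s ^ 2 + v2 s ^ 2) in *.
  set (d := fun s => u1 s ^ 2 + v1 s ^ 2) in *.
  set (m := fun s => u0 s ^ 2 + v0 s ^ 2) in *.
  set (g1 := fun s => u1 s * u0 s + v1 s * v0 s) in *.
  set (g2 := fun s => v1 s * u0 s - u1 s * v0 s) in *.
  set (h1 := fun s => u2 s * u0 s + v2 s * v0 s) in *.
  set (h2 := fun s => v2 s * u0 s - u2 s * v0 s) in *.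
  assert (Sa : derivable01 a) by derivable01_tac.
  assert (Sd : derivable01 d) by derivable01_tac.
  assert (Sm : derivable01 m) by derivable01_tac.
  assert (Sg1 : derivable01 g1) by derivable01_tac.
  assert (Sg2 : derivable01 g2) by derivable01_tac.
  assert (Sh1 : derivable01 h1) by derivable01_tac.
  assert (Sh2 : derivable01 h2) by derivable01_tac.
  assert (pos : forall f, derivable01 f -> (forall s, 0 <= f s) -> 0 <= RInt f 0 1).
  { intros f Hf Hp; apply RInt_ge_0; [lra|apply derivable01_ex_RInt|]; auto. }
  assert (dot : forall p q u v, p * u - q * v = p * u + (- q) * v)
    by (intros; ring).
  assert (HM : 0 < RInt m 0 1).
  { apply (RInt01_pos m s0); auto.
    - intros t; unfold m; nra.
    - rewrite C0 in Hw by trivial; unfold m.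
      destruct (Req_dec (u0 s0) 0) as [Z|Z]; [|nra].
      destruct (Req_dec (v0 s0) 0) as [Z'|Z']; [|nra].
      exfalso; apply Hw; rewrite Z, Z'; reflexivity. }
  assert (HH1 := RInt01_abs_le h1 a m 1 Sh1 Sa Sm ltac:(lra)
                   ltac:(intros s; apply two_abs_dot_le; lra)).
  assert (HH2 := RInt01_abs_le h2 a m 1 Sh2 Sa Sm ltac:(lra)
                   ltac:(intros s; unfold h2; rewrite dot;
                   eapply Rle_trans; [apply (two_abs_dot_le _ _ _ _ 1); lra|];
                   apply Req_le; unfold a, m; ring)).
  rewrite Rinv_1 in HH1, HH2.
  exists (RInt a 0 1), (RInt m 0 1), B0, B1, (RInt d 0 1),
    (RInt g1 0 1), (RInt g2 0 1), (RInt h1 0 1), (RInt h2 0 1).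
  split; [|split; [|split; [|split; [|split]]]].
  - repeat split; trivial; apply pos; auto; intros s; unfold a; nra.
  - rewrite I3.
    assert (X := Rle_abs (- RInt h1 0 1)); rewrite Rabs_Ropp in X; lra.
  - lra.
  - lra.
  - intros e He; split; apply RInt01_abs_le; auto; intros s.
    + apply two_abs_dot_le; auto.
    + unfold g2; rewrite dot.
      eapply Rle_trans; [apply (two_abs_dot_le _ _ _ _ e); lra|].
      apply Req_le; unfold d, m; ring.
  - split; simpl; fold g; lra.
Qed.

Lemma Rabs_le_of_sqr (x N : R) : 0 <= N -> x ^ 2 <= N ^ 2 -> Rabs x <= N.
Proof. intros HN H; unfold Rabs; destruct (Rcase_abs x); nra. Qed.

Lemma Rabs_le_both (x N : R) : Rabs x <= N -> x <= N /\ - x <= N.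
Proof. unfold Rabs; destruct (Rcase_abs x); lra. Qed.

Lemma Rabs_le_of_scaled (x a M c : R) :
  0 < a -> M <= a -> 0 <= c -> Rabs x * a <= c * M -> Rabs x <= c.
Proof.
  intros Ha HM Hc H; apply Rmult_le_reg_r with a; trivial.
  eapply Rle_trans; [exact H|]; apply Rmult_le_compat_l; lra.
Qed.

(** Divided by lambda, the quadratic equation reads
      lambda (M + alpha B1) + (alpha E + B1 + delta M) + Z = 0,
    with E = A + B0 and Z = g G + (E + eta H) / lambda; both parts of Z are at most
    (alpha / 4) E + C M when |lambda| is large.  If Re lambda <= - |Im lambda|
    fails, adding the real part to the modulus of the imaginary part gives
    E = O(M) and B1 = O(M), and then lambda itself is bounded. *)
Lemma quadratic_sector (alpha eta g delta kappa : R) :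
  0 < alpha -> 0 <= eta -> 0 <= g -> 0 <= delta -> 0 <= kappa ->
  exists L, 0 < L /\
  forall A M B0 B1 D G1 G2 H1 H2 x y N,
    0 <= A -> 0 < M -> 0 <= B0 -> 0 <= B1 ->
    D <= kappa * B0 + (A + M) / 2 ->
    2 * Rabs H1 <= A + M -> 2 * Rabs H2 <= A + M ->
    (forall e, 0 < e ->
       2 * Rabs G1 <= e * D + / e * M /\ 2 * Rabs G2 <= e * D + / e * M) ->
    (1 + alpha * x) * (A + B0 + x * B1) - alpha * y * (y * B1)
      + eta * H1 + g * (x * G1 - y * G2)
      + (delta * x + (x ^ 2 - y ^ 2)) * M = 0 ->
    alpha * y * (A + B0 + x * B1) + (1 + alpha * x) * (y * B1)
      + eta * H2 + g * (x * G2 + y * G1) + (delta * y + 2 * x * y) * M = 0 ->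
    N ^ 2 = x ^ 2 + y ^ 2 -> L < N ->
    x < 0 /\ Rabs y <= - x.
Proof.
  intros Ha He Hg Hd Hk.
  (* This e makes the contribution of g G to Z at most (alpha / 8) E + c1 M. *)
  set (e := alpha / (4 * (g + 1) * (kappa + 1))).
  assert (Pe : 0 < e) by (apply Rdiv_lt_0_compat; nra).
  assert (Pi : 0 < / e) by (apply Rinv_0_lt_compat; trivial).
  set (c1 := g / 2 * (e + / e)).
  assert (Pc1 : 0 <= c1) by (apply Rmult_le_pos; lra).
  set (C := c1 + eta).
  set (l := 8 * (1 + eta) / alpha).
  assert (Pl : 0 < l) by (apply Rdiv_lt_0_compat; lra).
  exists (8 * C + l + 1); split; [unfold C; lra|].
  intros A M B0 B1 D G1 G2 H1 H2 x y N PA PM PB0 PB1 HD HH1 HH2 HG E1 E2 HN HL.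
  assert (PC : 0 <= C) by (unfold C; lra).
  assert (PN : 1 <= N) by lra.
  set (E := A + B0); assert (PE : 0 <= E) by (unfold E; lra).
  set (a := M + alpha * B1).
  assert (PaB := Rmult_le_pos _ _ (Rlt_le _ _ Ha) PB1).
  assert (Pa : M <= a) by (unfold a; lra).
  assert (PaE := Rmult_le_pos _ _ (Rlt_le _ _ Ha) PE).
  assert (R1 : N ^ 2 * (x * a + alpha * E + B1 + delta * M + g * G1)
               + x * E + eta * (x * H1 + y * H2) = 0).
  { rewrite HN; unfold a, E.
    match type of E1 with ?l1 = 0 => match type of E2 with ?l2 = 0 =>
      transitivity (x * l1 + y * l2); [ring|rewrite E1, E2; ring] end end. }
  assert (R2 : N ^ 2 * (y * a + g * G2)
               - y * E + eta * (x * H2 - y * H1) = 0).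
  { rewrite HN; unfold a, E.
    match type of E1 with ?l1 = 0 => match type of E2 with ?l2 = 0 =>
      transitivity (x * l2 - y * l1); [ring|rewrite E1, E2; ring] end end. }
  assert (Hx : Rabs x <= N) by (apply Rabs_le_of_sqr; nra).
  assert (Hy : Rabs y <= N) by (apply Rabs_le_of_sqr; nra).
  set (K := (1 + eta) * E + eta * M).
  assert (PK : 0 <= K).
  { unfold K; assert (0 <= (1 + eta) * E) by (apply Rmult_le_pos; lra).
    assert (0 <= eta * M) by (apply Rmult_le_pos; lra); lra. }
  assert (prod : forall p q h, Rabs p <= N -> 2 * Rabs q <= h ->
                 Rabs (p * q) <= N * (h / 2)).
  { intros p q h Hp Hq; rewrite Rabs_mult.
    apply Rmult_le_compat; try apply Rabs_pos; lra. }
  assert (KE : N * E + eta * (N * (A + M)) <= N * K).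
  { replace (N * E + eta * (N * (A + M))) with (N * (E + eta * (A + M))) by ring.
    apply Rmult_le_compat_l; [lra|]; unfold K.
    assert (eta * A <= eta * E) by (apply Rmult_le_compat_l; unfold E; lra); lra. }
  assert (T1 : Rabs (x * E + eta * (x * H1 + y * H2)) <= N * K).
  { assert (X1 := prod x H1 _ Hx HH1); assert (X2 := prod y H2 _ Hy HH2).
    assert (X3 : Rabs (x * E) <= N * E).
    { rewrite Rabs_mult, (Rabs_pos_eq E) by lra; apply Rmult_le_compat_r; lra. }
    assert (X4 : Rabs (eta * (x * H1 + y * H2)) <= eta * (N * (A + M))).
    { rewrite Rabs_mult, (Rabs_pos_eq eta) by lra.
      apply Rmult_le_compat_l; [lra|].
      eapply Rle_trans; [apply Rabs_triang|lra]. }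
    eapply Rle_trans; [apply Rabs_triang|lra]. }
  assert (T2 : Rabs (- (y * E) + eta * (x * H2 - y * H1)) <= N * K).
  { assert (X1 := prod x H2 _ Hx HH2); assert (X2 := prod y H1 _ Hy HH1).
    assert (X3 : Rabs (- (y * E)) <= N * E).
    { rewrite Rabs_Ropp, Rabs_mult, (Rabs_pos_eq E) by lra;
        apply Rmult_le_compat_r; lra. }
    assert (X4 : Rabs (eta * (x * H2 - y * H1)) <= eta * (N * (A + M))).
    { rewrite Rabs_mult, (Rabs_pos_eq eta) by lra.
      apply Rmult_le_compat_l; [lra|].
      eapply Rle_trans; [apply Rabs_triang|rewrite Rabs_Ropp; lra]. }
    eapply Rle_trans; [apply Rabs_triang|lra]. }
  assert (KN : K <= N * (alpha / 8 * E + eta * M)).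
  { assert (alpha * l = 8 * (1 + eta)) by (unfold l; field; lra).
    assert (alpha * l <= alpha * N) by (apply Rmult_le_compat_l; lra).
    assert ((1 + eta) * E <= alpha / 8 * N * E) by (apply Rmult_le_compat_r; lra).
    assert (0 <= eta * M) by (apply Rmult_le_pos; lra).
    assert (1 * (eta * M) <= N * (eta * M)) by (apply Rmult_le_compat_r; lra).
    unfold K; lra. }
  assert (PN2 : 0 < N ^ 2) by nra.
  assert (NK : N * K <= N ^ 2 * (alpha / 8 * E + eta * M)).
  { replace (N ^ 2 * (alpha / 8 * E + eta * M))
      with (N * (N * (alpha / 8 * E + eta * M))) by ring.
    apply Rmult_le_compat_l; lra. }
  (* The real and the imaginary part of (E + eta H) / lambda are estimated. *)
  assert (S1 : Rabs (x * a + alpha * E + B1 + delta * M + g * G1)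
               <= alpha / 8 * E + eta * M).
  { apply Rmult_le_reg_l with (N ^ 2); trivial.
    rewrite <- (Rabs_pos_eq (N ^ 2)) at 1 by lra.
    rewrite <- Rabs_mult.
    replace (N ^ 2 * _) with (- (x * E + eta * (x * H1 + y * H2))) at 1 by lra.
    rewrite Rabs_Ropp; lra. }
  assert (S2 : Rabs (y * a + g * G2) <= alpha / 8 * E + eta * M).
  { apply Rmult_le_reg_l with (N ^ 2); trivial.
    rewrite <- (Rabs_pos_eq (N ^ 2)) at 1 by lra.
    rewrite <- Rabs_mult.
    replace (N ^ 2 * _) with (- (- (y * E) + eta * (x * H2 - y * H1))) at 1 by lra.
    rewrite Rabs_Ropp; lra. }
  assert (DE : D <= (kappa + 1) * E + M).
  { assert (kappa * B0 <= kappa * E)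
      by (apply Rmult_le_compat_l; unfold E; lra).
    unfold E in *; lra. }
  assert (HGe : forall G, 2 * Rabs G <= e * D + / e * M ->
                Rabs (g * G) <= alpha / 8 * E + c1 * M).
  { intros G HGG; rewrite Rabs_mult, (Rabs_pos_eq g) by lra.
    assert (e * D <= e * ((kappa + 1) * E + M))
      by (apply Rmult_le_compat_l; lra).
    assert (U : Rabs G <= (e * ((kappa + 1) * E + M) + / e * M) / 2) by lra.
    apply Rmult_le_compat_l with (r := g) in U; [|lra].
    assert (V : g * (e * (kappa + 1)) <= alpha / 4).
    { replace (e * (kappa + 1)) with (alpha / 4 * / (g + 1))
        by (unfold e; field; lra).
      assert (g * / (g + 1) <= 1).
      { apply Rmult_le_reg_r with (g + 1); [lra|].
        rewrite Rmult_assoc, Rinv_l; lra. }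
      assert (alpha / 4 * (g * / (g + 1)) <= alpha / 4 * 1)
        by (apply Rmult_le_compat_l; lra).
      lra. }
    assert (g * (e * (kappa + 1)) * E <= alpha / 4 * E)
      by (apply Rmult_le_compat_r; lra).
    unfold c1; lra. }
  destruct (HG e Pe) as [HG1 HG2].
  assert (V1 := Rabs_le_both _ _ (HGe _ HG1)).
  assert (V2 := Rabs_le_both _ _ (HGe _ HG2)).
  apply Rabs_le_both in S1, S2.
  assert (HC : C * M = c1 * M + eta * M) by (unfold C; ring).
  assert (Y1 : Rabs y * a <= alpha / 4 * E + C * M).
  { rewrite <- (Rabs_pos_eq a) by lra; rewrite <- Rabs_mult.
    apply Rabs_le; lra. }
  assert (X1 : - (alpha / 4 * E + C * M) <= - x * a - (alpha * E + B1 + delta * M)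
               <= alpha / 4 * E + C * M) by lra.
  (* The constants 2 C and 6 C come from alpha E <= 4 C M and B1 <= 2 C M. *)
  assert (Bad : - x <= Rabs y -> False).
  { intros Hbad.
    assert (- x * a <= Rabs y * a) by (apply Rmult_le_compat_r; lra).
    assert (PdM : 0 <= delta * M) by (apply Rmult_le_pos; lra).
    assert (PCM : 0 <= C * M) by (apply Rmult_le_pos; lra).
    assert (Ky : Rabs y <= 2 * C) by (apply (Rabs_le_of_scaled y a M); lra).
    assert (Kx : Rabs x <= 6 * C).
    { apply (Rabs_le_of_scaled x a M); try lra.
      rewrite <- (Rabs_pos_eq a) by lra; rewrite <- Rabs_mult.
      apply Rabs_le; lra. }
    assert (N <= Rabs x + Rabs y); [|lra].
    assert (Q1 := Rabs_pos x); assert (Q2 := Rabs_pos y).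
    rewrite <- (pow2_abs x), <- (pow2_abs y) in HN; nra. }
  destruct (Rlt_dec x 0) as [Lx|Lx]; [destruct (Rle_dec (Rabs y) (- x))|].
  - split; trivial.
  - exfalso; apply Bad; lra.
  - exfalso; apply Bad; assert (Q := Rabs_pos y); lra.
Qed.

(** Far away from the origin the eigenvalues lie in the left sector of half
    opening pi/4. *)
Lemma eigenvalue_sector (alpha eta beta delta : R) (b : boundary) :
  0 < alpha -> 0 <= eta -> 0 < beta < 1 -> 0 <= delta -> admissible b ->
  exists L, 0 < L /\ forall lambda,
    is_eigenvalue alpha eta beta delta b lambda -> L < Cmod lambda ->
    Re lambda < 0 /\ Rabs (Im lambda) <= - Re lambda.
Proof.
  intros Ha He Hbeta Hd Hb.
  assert (Hk : 0 <= trace_constant b).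
  { destruct b as [k|]; simpl; [|lra].
    destruct Hb as [(P1 & P2 & P3 & P4 & P5 & P6) _].
    apply Rinv_0_lt_compat in P1, P3, P4, P6; lra. }
  assert (Hg : 0 <= 2 * beta * sqrt eta)
    by (apply Rmult_le_pos; [lra|apply sqrt_pos]).
  destruct (quadratic_sector alpha eta (2 * beta * sqrt eta) delta
              (trace_constant b) Ha He Hg Hd Hk) as (L & HL & H).
  exists L; split; trivial; intros lambda HE HN.
  destruct (energy_identity _ _ _ _ _ _ Hb HE)
    as (A & M & B0 & B1 & D & G1 & G2 & H1 & H2 & (P1 & P2 & P3 & P4)
        & Q1 & Q2 & Q3 & Q4 & E1 & E2).
  apply (H A M B0 B1 D G1 G2 H1 H2 (Re lambda) (Im lambda) (Cmod lambda)); auto.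
  apply Cmod2_alt.
Qed.

(** * The initial value problem *)

Fixpoint linrec {T : Type} (next : T -> T -> T -> T) (y : nat -> T) (n : nat) : T :=
  match n with
  | S (S ((S ((S m) as m1)) as m2)) =>
      next (linrec next y m2) (linrec next y m1) (linrec next y m)
  | _ => y n
  end.

(** Solutions of a linear recurrence grow at most geometrically.  P x B is to be
    read as: x is bounded by B; the lemma is applied to complex sequences
    as well as to sequences of analytic functions. *)
Lemma linrec_bound {T : Type} (P : T -> R -> Prop) next (y : nat -> T) (K Y : R) :
  1 <= K -> 0 <= Y ->
  (forall x B B', P x B -> B <= B' -> P x B') ->
  (forall x2 x1 x0 B, 0 <= B -> P x2 B -> P x1 B -> P x0 B ->
     P (next x2 x1 x0) (K * B)) ->
  (forall i, (i < 4)%nat -> P (y i) Y) ->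
  forall n, P (linrec next y n) (Y * K ^ n).
Proof.
  intros HK HY mono step init n.
  assert (Hpow : forall i, Y * K ^ i <= Y * K ^ (S i)).
  { intros i; apply Rmult_le_compat_l; trivial.
    apply Rle_pow; [lra|lia]. }
  assert (Hpos : forall i, 0 <= Y * K ^ i)
    by (intros i; apply Rmult_le_pos; [|apply pow_le]; lra).
  induction n as [n IH] using lt_wf_ind.
  destruct n as [|[|[|[|m]]]].
  - apply mono with Y; [apply init; lia|simpl; lra].
  - apply mono with Y; [apply init; lia|specialize (Hpow 0%nat); simpl in *; lra].
  - apply mono with Y; [apply init; lia|].
    assert (X := Hpow 0%nat); specialize (Hpow 1%nat); simpl in *; lra.
  - apply mono with Y; [apply init; lia|].
    assert (X := Hpow 0%nat); assert (X' := Hpow 1%nat).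
    specialize (Hpow 2%nat); simpl in *; lra.
  - change (P (next (linrec next y (S (S m))) (linrec next y (S m)) (linrec next y m))
              (Y * K ^ S (S (S (S m))))).
    apply mono with (K * (Y * K ^ S (S m))).
    + apply step; trivial.
      * apply IH; lia.
      * apply mono with (Y * K ^ (S m)); [apply IH; lia|trivial].
      * apply mono with (Y * K ^ m); [apply IH; lia|].
        exact (Rle_trans _ _ _ (Hpow m) (Hpow (S m))).
    + replace (K * (Y * K ^ S (S m))) with (Y * K ^ S (S (S m))) by (simpl; ring).
      apply Hpow.
Qed.

(** Exponential generating function; the shift of sequences acts on it as
    differentiation. *)
Definition egf (x : nat -> C) (s : R) : C :=
  (PSeries (fun n => Re (x n) / INR (fact n)) s,
   PSeries (fun n => Im (x n) / INR (fact n)) s).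

Definition growth (x : nat -> C) (Y K : R) : Prop :=
  forall n, Cmod (x n) <= Y * K ^ n.

Lemma INR_fact_pos (n : nat) : 0 < INR (fact n).
Proof. apply lt_0_INR, lt_O_fact. Qed.

Lemma ex_series_exp (x : R) : ex_series (fun n => x ^ n / INR (fact n)).
Proof.
  apply ex_series_ext with (fun n => scal (pow_n x n) (/ INR (fact n))).
  - intros n; rewrite pow_n_pow; reflexivity.
  - exists (exp x); exact (is_exp_Reals x).
Qed.

Lemma Series_exp (x : R) : Series (fun n => x ^ n / INR (fact n)) = exp x.
Proof.
  apply is_series_unique.
  apply is_series_ext with (fun n => scal (pow_n x n) (/ INR (fact n))).
  - intros n; rewrite pow_n_pow; reflexivity.
  - exact (is_exp_Reals x).
Qed.

Lemma coefficient_bound (part : C -> R) (x : nat -> C) (Y K s : R) (n : nat) :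
  (forall z, Rabs (part z) <= Cmod z) -> growth x Y K -> 0 <= K ->
  Rabs (part (x n) / INR (fact n) * s ^ n)
  <= Y * ((K * Rabs s) ^ n / INR (fact n)).
Proof.
  intros Hp Hx HK; assert (F := INR_fact_pos n).
  assert (Fi := Rinv_0_lt_compat _ F).
  unfold Rdiv; rewrite !Rabs_mult, (Rabs_pos_eq (/ _)), <- RPow_abs, Rpow_mult_distr
    by lra.
  assert (A := Rle_trans _ _ _ (Hp (x n)) (Hx n)).
  replace (Y * _) with ((Y * K ^ n) * / INR (fact n) * Rabs s ^ n) by ring.
  apply Rmult_le_compat_r; [apply pow_le, Rabs_pos|].
  apply Rmult_le_compat_r; lra.
Qed.

Lemma ex_series_part (part : C -> R) (x : nat -> C) (Y K s : R) :
  (forall z, Rabs (part z) <= Cmod z) -> growth x Y K -> 0 <= K ->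
  ex_series (fun n => Rabs (part (x n) / INR (fact n) * s ^ n)).
Proof.
  intros Hp Hx HK.
  apply (@ex_series_le R_AbsRing R_CompleteNormedModule)
    with (fun n => Y * ((K * Rabs s) ^ n / INR (fact n))).
  - intros n; unfold norm; simpl; unfold abs; simpl.
    rewrite Rabs_Rabsolu; apply coefficient_bound; trivial.
  - apply (@ex_series_scal R_AbsRing R_NormedModule Y), ex_series_exp.
Qed.

Lemma PSeries_part_bound (part : C -> R) (x : nat -> C) (Y K s : R) :
  (forall z, Rabs (part z) <= Cmod z) -> growth x Y K -> 0 <= K ->
  Rabs (PSeries (fun n => part (x n) / INR (fact n)) s) <= Y * exp (K * Rabs s).
Proof.
  intros Hp Hx HK; unfold PSeries.
  eapply Rle_trans; [apply Series_Rabs, (ex_series_part part x Y K); trivial|].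
  rewrite <- Series_exp, <- Series_scal_l.
  apply Series_le.
  - intros n; split; [apply Rabs_pos|apply coefficient_bound; trivial].
  - apply (@ex_series_scal R_AbsRing R_NormedModule Y), ex_series_exp.
Qed.

(** A finite radius would make the terms at larger arguments not tend to 0. *)
Lemma CV_radius_part (part : C -> R) (x : nat -> C) (Y K : R) :
  (forall z, Rabs (part z) <= Cmod z) -> growth x Y K -> 0 <= K ->
  CV_radius (fun n => part (x n) / INR (fact n)) = p_infty.
Proof.
  intros Hp Hx HK.
  assert (H : forall r : R, Rbar_le r
                (CV_radius (fun n => part (x n) / INR (fact n)))).
  { intros r; apply Rbar_not_lt_le; intros Hlt.
    assert (Hr : Rbar_lt (CV_radius (fun n => part (x n) / INR (fact n))) (Rabs r)).
    { eapply Rbar_lt_le_trans; [exact Hlt|]; simpl; apply Rle_abs. }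
    apply (CV_disk_outside _ _ Hr).
    apply ex_series_lim_0, ex_series_Rabs, (ex_series_part part x Y K); trivial. }
  destruct (CV_radius _) as [r| |]; trivial.
  - specialize (H (r + 1)); simpl in H; lra.
  - destruct (H 0).
Qed.

Lemma egf_ext (x x' : nat -> C) (s : R) :
  (forall n, x n = x' n) -> egf x s = egf x' s.
Proof.
  intros H; unfold egf; f_equal; apply PSeries_ext; intros n; rewrite H; trivial.
Qed.

Lemma egf_0 (x : nat -> C) : egf x 0 = x 0%nat.
Proof.
  unfold egf; rewrite !PSeries_0; simpl; unfold Rdiv.
  rewrite !Rinv_1, !Rmult_1_r; symmetry; apply surjective_pairing.
Qed.

Lemma Cmod_egf_le (x : nat -> C) (Y K : R) :
  growth x Y K -> 0 <= K -> Cmod (egf x 1) <= 2 * (Y * exp K).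
Proof.
  intros Hx HK; eapply Rle_trans; [apply Cmod_le_Re_Im|]; unfold egf; simpl.
  assert (A := PSeries_part_bound Re x Y K 1 re_le_Cmod Hx HK).
  assert (B := PSeries_part_bound Im x Y K 1 im_le_Cmod Hx HK).
  rewrite Rabs_R1, Rmult_1_r in A, B; lra.
Qed.

Lemma egf_derive (x : nat -> C) (Y K : R) :
  growth x Y K -> 0 <= K -> derivative01 (egf x) (egf (fun n => x (S n))).
Proof.
  intros Hx HK; apply derivative01_of_parts.
  assert (P : forall part : C -> R, (forall z, Rabs (part z) <= Cmod z) ->
    forall s, is_derive (PSeries (fun n => part (x n) / INR (fact n))) s
                (PSeries (fun n => part (x (S n)) / INR (fact n)) s)).
  { intros part Hp s.
    replace (PSeries (fun n => part (x (S n)) / INR (fact n)) s)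
      with (PSeries (PS_derive (fun n => part (x n) / INR (fact n))) s).
    - apply is_derive_PSeries; rewrite (CV_radius_part part x Y K); simpl; trivial.
    - apply PSeries_ext; intros n; unfold PS_derive.
      rewrite fact_simpl, mult_INR; field.
      split; [apply INR_fact_neq_0|apply not_0_INR; lia]. }
  intros s _; split; [apply (P Re re_le_Cmod)|apply (P Im im_le_Cmod)].
Qed.

Lemma egf_lin (x x' : nat -> C) (Y K Y' K' : R) (p q : C) (s : R) :
  growth x Y K -> 0 <= K -> growth x' Y' K' -> 0 <= K' ->
  egf (fun n => p * x n + q * x' n)%C s = (p * egf x s + q * egf x' s)%C.
Proof.
  intros Hx HK Hx' HK'.
  assert (ex : forall (part : C -> R) z Z k, (forall z, Rabs (part z) <= Cmod z) ->
    growth z Z k -> 0 <= k ->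
    ex_series (fun n => part (z n) / INR (fact n) * s ^ n)).
  { intros part z Z k Hp Hz Hk.
    apply ex_series_Rabs, (ex_series_part part z Z k); trivial. }
  assert (R1 := ex Re x Y K re_le_Cmod Hx HK).
  assert (I1 := ex Im x Y K im_le_Cmod Hx HK).
  assert (R2 := ex Re x' Y' K' re_le_Cmod Hx' HK').
  assert (I2 := ex Im x' Y' K' im_le_Cmod Hx' HK').
  assert (lin : forall f1 f2 f3 f4 (c1 c2 c3 c4 : R),
    ex_series f1 -> ex_series f2 -> ex_series f3 -> ex_series f4 ->
    Series (fun n => c1 * f1 n + c2 * f2 n + (c3 * f3 n + c4 * f4 n))
    = c1 * Series f1 + c2 * Series f2 + (c3 * Series f3 + c4 * Series f4)).
  { intros f1 f2 f3 f4 c1 c2 c3 c4 e1 e2 e3 e4.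
    assert (sc : forall f (c : R), ex_series f -> ex_series (fun n => c * f n))
      by (intros f c; apply (@ex_series_scal R_AbsRing R_NormedModule c)).
    assert (pl : forall f g, ex_series f -> ex_series g ->
                 ex_series (fun n => f n + g n))
      by (intros f g; apply (@ex_series_plus R_AbsRing R_NormedModule)).
    rewrite !Series_plus, !Series_scal_l; auto. }
  destruct p as [p1 p2], q as [q1 q2].
  unfold egf, PSeries, Cmult, Cplus; simpl fst; simpl snd; f_equal.
  - transitivity (p1 * Series (fun n => Re (x n) / INR (fact n) * s ^ n)
      + - p2 * Series (fun n => Im (x n) / INR (fact n) * s ^ n)
      + (q1 * Series (fun n => Re (x' n) / INR (fact n) * s ^ n)
         + - q2 * Series (fun n => Im (x' n) / INR (fact n) * s ^ n))); [|ring].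
    rewrite <- (lin _ _ _ _ p1 (- p2) q1 (- q2) R1 I1 R2 I2).
    apply Series_ext; intros n; destruct (x n), (x' n); simpl; unfold Rdiv; ring.
  - transitivity (p1 * Series (fun n => Im (x n) / INR (fact n) * s ^ n)
      + p2 * Series (fun n => Re (x n) / INR (fact n) * s ^ n)
      + (q1 * Series (fun n => Im (x' n) / INR (fact n) * s ^ n)
         + q2 * Series (fun n => Re (x' n) / INR (fact n) * s ^ n))); [|ring].
    rewrite <- (lin _ _ _ _ p1 p2 q1 q2 I1 R1 I2 R2).
    apply Series_ext; intros n; destruct (x n), (x' n); simpl; unfold Rdiv; ring.
Qed.

Definition next_coef (a b c x2 x1 x0 : C) : C :=
  (- (a * x2 + b * x1 + c * x0))%C.

Lemma Cmod_next_coef (a b c x2 x1 x0 : C) :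
  Cmod (next_coef a b c x2 x1 x0)
  <= Cmod a * Cmod x2 + Cmod b * Cmod x1 + Cmod c * Cmod x0.
Proof.
  unfold next_coef; rewrite Cmod_opp.
  eapply Rle_trans; [apply Cmod_triangle|].
  rewrite (Cmod_mult c); apply Rplus_le_compat_r.
  eapply Rle_trans; [apply Cmod_triangle|]; rewrite !Cmod_mult; lra.
Qed.

(** The j-th derivative of the solution of w'''' + a w'' + b w' + c w = 0
    whose first four derivatives at 0 are y 0, ..., y 3. *)
Definition jet (a b c : C) (y : nat -> C) (j : nat) : R -> C :=
  egf (fun n => linrec (next_coef a b c) y (j + n)).

Lemma linrec_growth (a b c : C) (y : nat -> C) :
  exists K, 0 <= K /\ forall j, exists Y,
    growth (fun n => linrec (next_coef a b c) y (j + n)) Y K.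
Proof.
  set (K := 1 + Cmod a + Cmod b + Cmod c).
  assert (Pa := Cmod_ge_0 a); assert (Pb := Cmod_ge_0 b); assert (Pc := Cmod_ge_0 c).
  exists K; split; [unfold K; lra|]; intros j.
  set (Y := Cmod (y 0%nat) + Cmod (y 1%nat) + Cmod (y 2%nat) + Cmod (y 3%nat)).
  assert (P0 := Cmod_ge_0 (y 0%nat)); assert (P1 := Cmod_ge_0 (y 1%nat)).
  assert (P2 := Cmod_ge_0 (y 2%nat)); assert (P3 := Cmod_ge_0 (y 3%nat)).
  exists (Y * K ^ j); intros n.
  rewrite Rmult_assoc, <- pow_add.
  apply (linrec_bound (fun x B => Cmod x <= B)); try (unfold K, Y; lra).
  - intros x B B'; apply Rle_trans.
  - intros x2 x1 x0 B HB H2 H1 H0.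
    eapply Rle_trans; [apply Cmod_next_coef|].
    assert (Cmod a * Cmod x2 <= Cmod a * B) by (apply Rmult_le_compat_l; lra).
    assert (Cmod b * Cmod x1 <= Cmod b * B) by (apply Rmult_le_compat_l; lra).
    assert (Cmod c * Cmod x0 <= Cmod c * B) by (apply Rmult_le_compat_l; lra).
    unfold K; lra.
  - intros i Hi; unfold Y.
    destruct i as [|[|[|[|i]]]]; try lia; lra.
Qed.

Lemma jet_derive (a b c : C) (y : nat -> C) (j : nat) :
  derivative01 (jet a b c y j) (jet a b c y (S j)).
Proof.
  destruct (linrec_growth a b c y) as (K & HK & G); destruct (G j) as [Y HY].
  intros s Hs.
  replace (jet a b c y (S j) s)
    with (egf (fun n => linrec (next_coef a b c) y (j + S n)) s).
  - exact (egf_derive _ Y K HY HK s Hs).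
  - apply egf_ext; intros n; f_equal; lia.
Qed.

Lemma jet_equation (a b c : C) (y : nat -> C) (s : R) :
  jet a b c y 4 s
  = next_coef a b c (jet a b c y 2 s) (jet a b c y 1 s) (jet a b c y 0 s).
Proof.
  destruct (linrec_growth a b c y) as (K & HK & G).
  destruct (G 0%nat) as [Y0 H0], (G 1%nat) as [Y1 H1], (G 2%nat) as [Y2 H2].
  set (x := linrec (next_coef a b c) y) in *.
  assert (H10 : growth (fun n => - b * x (1 + n)%nat + - c * x (0 + n)%nat)%C
                  (Cmod b * Y1 + Cmod c * Y0) K).
  { intros n; eapply Rle_trans; [apply Cmod_triangle|].
    rewrite !Cmod_mult, !Cmod_opp.
    specialize (H0 n); specialize (H1 n).
    assert (Cmod b * Cmod (x (1 + n)%nat) <= Cmod b * (Y1 * K ^ n))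
      by (apply Rmult_le_compat_l; [apply Cmod_ge_0|trivial]).
    assert (Cmod c * Cmod (x (0 + n)%nat) <= Cmod c * (Y0 * K ^ n))
      by (apply Rmult_le_compat_l; [apply Cmod_ge_0|trivial]).
    lra. }
  unfold jet; fold x.
  transitivity (egf (fun n => - a * x (2 + n)%nat
                   + 1 * (- b * x (1 + n)%nat + - c * x (0 + n)%nat))%C s).
  - apply egf_ext; intros n.
    change (x (4 + n)%nat)
      with (next_coef a b c (x (2 + n)%nat) (x (1 + n)%nat) (x (0 + n)%nat)).
    unfold next_coef; ring.
  - rewrite (egf_lin _ _ Y2 K _ K _ _ s H2 HK H10 HK),
            (egf_lin _ _ Y1 K Y0 K _ _ s H1 HK H0 HK).
    unfold next_coef; ring.
Qed.

Lemma jet_initial (a b c : C) (y : nat -> C) (j : nat) :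
  (j < 4)%nat -> jet a b c y j 0 = y j.
Proof.
  intros Hj; unfold jet; rewrite egf_0, Nat.add_0_r.
  destruct j as [|[|[|[|j]]]]; trivial; lia.
Qed.

Lemma linrec_lin (a b c : C) (y y' : nat -> C) (p q : C) (n : nat) :
  linrec (next_coef a b c) (fun j => p * y j + q * y' j)%C n
  = (p * linrec (next_coef a b c) y n + q * linrec (next_coef a b c) y' n)%C.
Proof.
  induction n as [n IH] using lt_wf_ind.
  destruct n as [|[|[|[|m]]]]; trivial.
  change (next_coef a b c (linrec (next_coef a b c) (fun j => p * y j + q * y' j)%C (S (S m)))
    (linrec (next_coef a b c) (fun j => p * y j + q * y' j)%C (S m))
    (linrec (next_coef a b c) (fun j => p * y j + q * y' j)%C m)
    = p * next_coef a b c (linrec (next_coef a b c) y (S (S m)))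
        (linrec (next_coef a b c) y (S m)) (linrec (next_coef a b c) y m)
      + q * next_coef a b c (linrec (next_coef a b c) y' (S (S m)))
        (linrec (next_coef a b c) y' (S m)) (linrec (next_coef a b c) y' m))%C.
  rewrite !IH by lia; unfold next_coef; ring.
Qed.

Lemma jet_lin (a b c : C) (y y' : nat -> C) (p q : C) (j : nat) (s : R) :
  jet a b c (fun j => p * y j + q * y' j)%C j s
  = (p * jet a b c y j s + q * jet a b c y' j s)%C.
Proof.
  destruct (linrec_growth a b c y) as (K & HK & G); destruct (G j) as [Y HY].
  destruct (linrec_growth a b c y') as (K' & HK' & G'); destruct (G' j) as [Y' HY'].
  unfold jet; rewrite <- (egf_lin _ _ Y K Y' K' p q s HY HK HY' HK').
  apply egf_ext; intros n; apply linrec_lin.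
Qed.

Lemma derivative01_minus (f f' g g' : R -> C) :
  derivative01 f f' -> derivative01 g g' ->
  derivative01 (fun s => f s - g s)%C (fun s => f' s - g' s)%C.
Proof.
  intros Hf Hg s Hs; apply is_derive01_eps; trivial; intros eps He.
  destruct (proj1 (is_derive01_eps f s _ Hs) (Hf s Hs) (eps / 2) ltac:(lra))
    as (d1 & P1 & Q1).
  destruct (proj1 (is_derive01_eps g s _ Hs) (Hg s Hs) (eps / 2) ltac:(lra))
    as (d2 & P2 & Q2).
  exists (Rmin d1 d2); split; [apply Rmin_pos; trivial|]; intros y Hy Hd.
  specialize (Q1 y Hy (Rlt_le_trans _ _ _ Hd (Rmin_l _ _))).
  specialize (Q2 y Hy (Rlt_le_trans _ _ _ Hd (Rmin_r _ _))).
  replace (f y - g y - (f s - g s) - RtoC (y - s) * (f' s - g' s))%C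
    with ((f y - f s - RtoC (y - s) * f' s)
          + - (g y - g s - RtoC (y - s) * g' s))%C by ring.
  eapply Rle_trans; [apply Cmod_triangle|]; rewrite Cmod_opp; lra.
Qed.

(** Gronwall's argument: e = |w|^2 + ... + |w'''|^2 satisfies e' <= (3 + k) e, so
    that e(s) exp(- (3 + k) s) decreases from 0. *)
Lemma cauchy_problem_zero (a b c : C) (w w1 w2 w3 w4 : R -> C) :
  derivative01 w w1 -> derivative01 w1 w2 ->
  derivative01 w2 w3 -> derivative01 w3 w4 ->
  (forall s, unit_interval s -> w4 s = next_coef a b c (w2 s) (w1 s) (w s)) ->
  w 0 = 0%C -> w1 0 = 0%C -> w2 0 = 0%C -> w3 0 = 0%C ->
  forall s, unit_interval s ->
    w s = 0%C /\ w1 s = 0%C /\ w2 s = 0%C /\ w3 s = 0%C.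
Proof.
  intros D0 D1 D2 D3 Eq I0 I1 I2 I3 s Hs.
  destruct (derivative01_parts _ _ D0) as (u0 & v0 & P0).
  destruct (derivative01_parts _ _ D1) as (u1 & v1 & P1).
  destruct (derivative01_parts _ _ D2) as (u2 & v2 & P2).
  destruct (derivative01_parts _ _ D3) as (u3 & v3 & P3).
  set (e := fun t => u0 t * u0 t + v0 t * v0 t + (u1 t * u1 t + v1 t * v1 t)
               + (u2 t * u2 t + v2 t * v2 t) + (u3 t * u3 t + v3 t * v3 t)).
  set (k := Cmod a ^ 2 + Cmod b ^ 2 + Cmod c ^ 2).
  assert (Ee : forall t, unit_interval t ->
    e t = Cmod (w t) ^ 2 + Cmod (w1 t) ^ 2 + Cmod (w2 t) ^ 2 + Cmod (w3 t) ^ 2).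
  { intros t Ht; rewrite !Cmod2_alt; unfold e.
    destruct (P0 t Ht) as [-> _], (P1 t Ht) as [-> _],
      (P2 t Ht) as [-> _], (P3 t Ht) as [-> _]; simpl; ring. }
  set (de := fun t => 2 * (u0 t * Re (w1 t) + v0 t * Im (w1 t))
     + 2 * (u1 t * Re (w2 t) + v1 t * Im (w2 t))
     + 2 * (u2 t * Re (w3 t) + v2 t * Im (w3 t))
     + 2 * (u3 t * Re (w4 t) + v3 t * Im (w4 t))).
  assert (De : forall t, unit_interval t -> is_derive e t (de t)).
  { intros t Ht.
    destruct (P0 t Ht) as (_ & A0 & B0), (P1 t Ht) as (_ & A1 & B1),
      (P2 t Ht) as (_ & A2 & B2), (P3 t Ht) as (_ & A3 & B3).
    assert (sq : forall f l, is_derive f t l ->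
                 is_derive (fun t => f t * f t) t (2 * (f t * l))).
    { intros f l Hf; replace (2 * (f t * l)) with (l * f t + f t * l) by ring.
      apply (@is_derive_mult R_AbsRing f f t l l Hf Hf Rmult_comm). }
    unfold e, de; rewrite !Rmult_plus_distr_l.
    repeat apply (@is_derive_plus R_AbsRing R_NormedModule); apply sq; trivial. }
  assert (Le : forall t, unit_interval t -> de t <= (3 + k) * e t).
  { intros t Ht; rewrite (Ee t Ht).
    assert (W4 : Cmod (w4 t) ^ 2
      <= k * (Cmod (w t) ^ 2 + Cmod (w1 t) ^ 2 + Cmod (w2 t) ^ 2)).
    { rewrite (Eq t Ht).
      assert (X := Cmod_next_coef a b c (w2 t) (w1 t) (w t)).
      apply (fun H => pow_incr _ _ 2 (conj (Cmod_ge_0 _) H)) in X.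
      eapply Rle_trans; [exact X|]; unfold k.
      generalize (Cmod a) (Cmod b) (Cmod c) (Cmod (w2 t)) (Cmod (w1 t)) (Cmod (w t)).
      intros p q r x2 x1 x0.
      assert (Y1 := pow2_ge_0 (p * x1 - q * x2)).
      assert (Y2 := pow2_ge_0 (p * x0 - r * x2)).
      assert (Y3 := pow2_ge_0 (q * x0 - r * x1)).
      nra. }
    assert (dot : forall f g, 2 * (Re f * Re g + Im f * Im g)
                  <= Cmod f ^ 2 + Cmod g ^ 2).
    { intros f g; rewrite !Cmod2_alt.
      assert (Y1 := pow2_ge_0 (Re f - Re g)).
      assert (Y2 := pow2_ge_0 (Im f - Im g)); nra. }
    assert (X0 := dot (w t) (w1 t)); assert (X1 := dot (w1 t) (w2 t)).
    assert (X2 := dot (w2 t) (w3 t)); assert (X3 := dot (w3 t) (w4 t)).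
    assert (Z : de t = 2 * (Re (w t) * Re (w1 t) + Im (w t) * Im (w1 t))
     + 2 * (Re (w1 t) * Re (w2 t) + Im (w1 t) * Im (w2 t))
     + 2 * (Re (w2 t) * Re (w3 t) + Im (w2 t) * Im (w3 t))
     + 2 * (Re (w3 t) * Re (w4 t) + Im (w3 t) * Im (w4 t))).
    { unfold de; destruct (P0 t Ht) as [E0 _], (P1 t Ht) as [E1 _],
        (P2 t Ht) as [E2 _], (P3 t Ht) as [E3 _].
      rewrite E0, E1, E2, E3; reflexivity. }
    rewrite Z.
    assert (0 <= k) by (unfold k; repeat apply Rplus_le_le_0_compat; apply pow2_ge_0).
    assert (N0 := pow2_ge_0 (Cmod (w t))); assert (N1 := pow2_ge_0 (Cmod (w1 t))).
    assert (N2 := pow2_ge_0 (Cmod (w2 t))); assert (N3 := pow2_ge_0 (Cmod (w3 t))).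
    assert (0 <= k * Cmod (w3 t) ^ 2) by (apply Rmult_le_pos; trivial).
    lra. }
  assert (E0 : e 0 = 0).
  { rewrite Ee, I0, I1, I2, I3, Cmod_0 by (split; lra); ring. }
  assert (Es : e s <= 0).
  { destruct (Rle_lt_or_eq_dec 0 s (proj1 Hs)) as [Lt|<-]; [|lra].
    destruct (MVT_cor2 (fun t => e t * exp (- (3 + k) * t))
      (fun t => (de t - (3 + k) * e t) * exp (- (3 + k) * t)) 0 s Lt)
      as (t & Ht & Ht').
    { intros t Ht; apply is_derive_Reals.
      assert (Hu : unit_interval t) by (destruct Hs; split; lra).
      replace ((de t - (3 + k) * e t) * exp (- (3 + k) * t))
        with (de t * exp (- (3 + k) * t)
              + e t * (- (3 + k) * exp (- (3 + k) * t))) by ring.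
      apply (@is_derive_mult R_AbsRing e (fun t => exp (- (3 + k) * t)) t);
        [exact (De t Hu)| |exact Rmult_comm].
      auto_derive; trivial; ring. }
    assert (Hu : unit_interval t) by (destruct Hs; split; lra).
    specialize (Le t Hu); rewrite E0 in Ht.
    assert (X := exp_pos (- (3 + k) * s)); assert (Y := exp_pos (- (3 + k) * t)).
    assert (0 <= ((3 + k) * e t - de t) * (exp (- (3 + k) * t) * (s - 0)))
      by (repeat apply Rmult_le_pos; lra).
    apply Rmult_le_reg_r with (exp (- (3 + k) * s)); lra. }
  rewrite (Ee s Hs) in Es.
  assert (N0 := pow2_ge_0 (Cmod (w s))); assert (N1 := pow2_ge_0 (Cmod (w1 s))).
  assert (N2 := pow2_ge_0 (Cmod (w2 s))); assert (N3 := pow2_ge_0 (Cmod (w3 s))).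
  assert (Z : forall z, Cmod z ^ 2 <= 0 -> z = 0%C).
  { intros z Hz; apply Cmod_eq_0; nra. }
  repeat split; apply Z; lra.
Qed.

Lemma cauchy_problem_unique (a b c : C) (w w1 w2 w3 w4 : R -> C) (y : nat -> C) :
  derivative01 w w1 -> derivative01 w1 w2 ->
  derivative01 w2 w3 -> derivative01 w3 w4 ->
  (forall s, unit_interval s -> w4 s = next_coef a b c (w2 s) (w1 s) (w s)) ->
  w 0 = y 0%nat -> w1 0 = y 1%nat -> w2 0 = y 2%nat -> w3 0 = y 3%nat ->
  forall s, unit_interval s ->
    w s = jet a b c y 0 s /\ w1 s = jet a b c y 1 s /\
    w2 s = jet a b c y 2 s /\ w3 s = jet a b c y 3 s.
Proof.
  intros D0 D1 D2 D3 Eq I0 I1 I2 I3 s Hs.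
  set (J := jet a b c y).
  assert (E : forall p q : C, (p - q)%C = 0%C -> p = q).
  { intros p q H; replace p with (p - q + q)%C by ring; rewrite H; ring. }
  assert (Z : forall p q : C, p = q -> (p - q)%C = 0%C) by (intros p q ->; ring).
  destruct (cauchy_problem_zero a b c (fun t => w t - J 0%nat t)%C
    (fun t => w1 t - J 1%nat t)%C (fun t => w2 t - J 2%nat t)%C
    (fun t => w3 t - J 3%nat t)%C (fun t => w4 t - J 4%nat t)%C) with (s := s)
    as (A0 & A1 & A2 & A3); auto; try (apply derivative01_minus; auto; apply jet_derive);
    try (unfold J; rewrite jet_initial by lia; auto).
  intros t Ht; unfold J; rewrite jet_equation, Eq by trivial; unfold next_coef; ring.
Qed.

(** * Analytic functions on the unit disc *)

(** F k is the k-th iterated difference quotient at 0: F 0 = f and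
    F (k + 1) t = (F k t - F k 0) / t, so that F k 0 is the k-th Taylor
    coefficient. *)
Definition quotients (F : nat -> C -> C) : Prop :=
  forall k t, Cmod t < 1 -> F k t = (F k 0 + t * F (S k) t)%C.

Definition bounded_on (rho : R) (F : nat -> C -> C) (B : R) : Prop :=
  forall k t, Cmod t < rho -> Cmod (F k t) * rho ^ k <= B.

Definition expansion (f : C -> C) (F : nat -> C -> C) : Prop :=
  (forall t, Cmod t < 1 -> F 0%nat t = f t) /\ quotients F /\
  forall rho, 0 < rho < 1 -> exists B, bounded_on rho F B.

(** Analyticity on the unit disc, by Cauchy's estimates for the difference
    quotients.  Unlike the convergence of the Taylor series this notion passes
    through products and infinite sums without rearranging double series. *)
Definition analytic (f : C -> C) : Prop := exists F, expansion f F.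

Lemma bounded_on_nonneg (rho : R) F (B : R) : 0 < rho -> bounded_on rho F B -> 0 <= B.
Proof.
  intros Hr H; specialize (H 0%nat 0%C).
  rewrite Cmod_0 in H; specialize (H Hr); simpl in H.
  assert (X := Cmod_ge_0 (F 0%nat 0%C)); lra.
Qed.

(** Induction on the number of vanishing Taylor coefficients: if
    f(t) = t^k F k t, the zeros of f are zeros of F k, whence F k 0 = 0. *)
Lemma analytic_identity (f : C -> C) :
  analytic f ->
  (forall d, 0 < d -> exists t : C, t <> 0%C /\ Cmod t < d /\ f t = 0%C) ->
  forall t, Cmod t < 1 -> f t = 0%C.
Proof.
  intros (F & F0 & FQ & FB) Z.
  assert (Hk : forall k t, Cmod t < 1 -> f t = (t ^ k * F k t)%C).
  { intros k; induction k as [|k IH]; intros t Ht.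
    - rewrite F0 by trivial; simpl; ring.
    - assert (E : F k 0%C = 0%C).
      { apply Cmod_eq_0, Rle_antisym; [|apply Cmod_ge_0].
        destruct (FB (/ 2) ltac:(lra)) as [B HB].
        assert (PB := bounded_on_nonneg (/ 2) F B ltac:(lra) HB).
        assert (Ph : 0 < (/ 2) ^ S k) by (apply pow_lt; lra).
        apply le_epsilon; intros eps Heps.
        destruct (Z (Rmin (/ 2) (eps * (/ 2) ^ S k / (B + 1)))) as (z & Nz & Lz & Ez).
        { apply Rmin_pos; [lra|].
          apply Rdiv_lt_0_compat; [apply Rmult_lt_0_compat; lra|lra]. }
        assert (L1 := Rlt_le_trans _ _ _ Lz (Rmin_l _ _)).
        assert (L2 := Rlt_le_trans _ _ _ Lz (Rmin_r _ _)).
        assert (Zk : F k z = 0%C).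
        { rewrite (IH z ltac:(lra)) in Ez.
          assert (P : (z ^ k)%C <> 0%C) by (apply Cpow_nz; exact Nz).
          replace (F k z) with (/ (z ^ k) * (z ^ k * F k z))%C by (field; trivial).
          rewrite Ez; ring. }
        rewrite (FQ k z ltac:(lra)) in Zk.
        replace (F k 0%C) with (- (z * F (S k) z))%C
          by (replace (F k 0%C) with (F k 0%C + z * F (S k) z - z * F (S k) z)%C by ring;
              rewrite Zk; ring).
        rewrite Cmod_opp, Cmod_mult, Rplus_0_l.
        specialize (HB (S k) z L1).
        apply Rmult_le_reg_r with ((/ 2) ^ S k); trivial.
        rewrite Rmult_assoc.
        apply Rle_trans with (eps * (/ 2) ^ S k / (B + 1) * B).
        + apply Rmult_le_compat; try lra; [apply Cmod_ge_0|].
          apply Rmult_le_pos; [apply Cmod_ge_0|lra].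
        + unfold Rdiv; rewrite Rmult_assoc.
          rewrite <- (Rmult_1_r (eps * (/ 2) ^ S k)) at 2.
          apply Rmult_le_compat_l; [apply Rmult_le_pos; lra|].
          apply Rmult_le_reg_l with (B + 1); [lra|].
          rewrite <- Rmult_assoc, Rinv_r; lra. }
      rewrite (IH t Ht), (FQ k t Ht), E; simpl; ring. }
  intros t Ht.
  set (rho := (1 + Cmod t) / 2).
  assert (P := Cmod_ge_0 t).
  assert (Hr : 0 < rho < 1) by (unfold rho; lra).
  assert (Hlt : Cmod t < rho) by (unfold rho; lra).
  destruct (FB rho Hr) as [B HB].
  set (q := Cmod t / rho).
  assert (Hq : Rabs q < 1).
  { unfold q; rewrite Rabs_pos_eq by (apply Rdiv_le_0_compat; lra).
    apply Rmult_lt_reg_r with rho; [lra|].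
    unfold Rdiv; rewrite Rmult_assoc, Rinv_l; lra. }
  assert (Hf : forall k, Cmod (f t) <= B * q ^ k).
  { intros k; rewrite (Hk k t Ht), Cmod_mult, Cmod_pow.
    unfold q, Rdiv; rewrite Rpow_mult_distr, pow_inv.
    assert (Pk : 0 < rho ^ k) by (apply pow_lt; lra).
    specialize (HB k t Hlt).
    replace (Cmod t ^ k * Cmod (F k t))
      with (Cmod (F k t) * rho ^ k * (Cmod t ^ k * / rho ^ k)) by (field; lra).
    apply Rmult_le_compat_r; trivial.
    apply Rmult_le_pos; [apply pow_le; lra|].
    apply Rlt_le, Rinv_0_lt_compat; lra. }
  apply Cmod_eq_0, Rle_antisym; [|apply Cmod_ge_0].
  apply (is_lim_seq_le (fun _ => Cmod (f t)) (fun k => B * q ^ k) (Cmod (f t)) 0 Hf).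
  - apply is_lim_seq_const.
  - replace (Finite 0) with (Rbar_mult B 0) by (simpl; f_equal; ring).
    apply is_lim_seq_scal_l, is_lim_seq_geom; trivial.
Qed.

Lemma analytic_ext (f g : C -> C) :
  (forall t, Cmod t < 1 -> f t = g t) -> analytic f -> analytic g.
Proof.
  intros H (F & F0 & FQ & FB); exists F; split; [|split]; trivial.
  intros t Ht; rewrite F0, H; trivial.
Qed.

Lemma analytic_const (c : C) : analytic (fun _ => c).
Proof.
  exists (fun k _ => match k with O => c | S _ => 0%C end).
  split; [|split]; trivial.
  - intros [|k] t _; ring.
  - intros rho Hr; exists (Cmod c); intros [|k] t _; simpl.
    + lra.
    + rewrite Cmod_0, Rmult_0_l; apply Cmod_ge_0.
Qed.

Lemma analytic_plus (f g : C -> C) :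
  analytic f -> analytic g -> analytic (fun t => f t + g t)%C.
Proof.
  intros (F & F0 & FQ & FB) (G & G0 & GQ & GB).
  exists (fun k t => F k t + G k t)%C; split; [|split].
  - intros t Ht; rewrite F0, G0; trivial.
  - intros k t Ht; rewrite (FQ k t Ht), (GQ k t Ht); ring.
  - intros rho Hr; destruct (FB rho Hr) as [B HB], (GB rho Hr) as [B' HB'].
    exists (B + B'); intros k t Ht; specialize (HB k t Ht); specialize (HB' k t Ht).
    assert (0 <= rho ^ k) by (apply pow_le; lra).
    eapply Rle_trans; [apply Rmult_le_compat_r; [trivial|apply Cmod_triangle]|].
    lra.
Qed.

(** Leibniz' rule for difference quotients: D(f g) = f(0) D g + (D f) g. *)
Fixpoint product (F G : nat -> C -> C) (k : nat) (t : C) : C :=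
  match k with
  | O => F O t * G O t
  | S k' => F O 0 * G k t + product (fun j => F (S j)) G k' t
  end%C.

Lemma product_quotients (F G : nat -> C -> C) :
  quotients F -> quotients G -> quotients (product F G).
Proof.
  intros HF HG k; revert F HF; induction k as [|k IH]; intros F HF t Ht.
  - simpl; rewrite (HF 0%nat t Ht), (HG 0%nat t Ht) at 1.
    transitivity (F 0%nat 0 * G 0%nat 0
      + t * (F 0%nat 0 * G 1%nat t
             + F 1%nat t * (G 0%nat 0 + t * G 1%nat t)))%C; [ring|].
    rewrite <- (HG 0%nat t Ht); reflexivity.
  - change (F 0%nat 0 * G (S k) t + product (fun j => F (S j)) G k t
      = F 0%nat 0 * G (S k) 0 + product (fun j => F (S j)) G k 0
        + t * (F 0%nat 0 * G (S (S k)) t + product (fun j => F (S j)) G (S k) t))%C.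
    rewrite (IH (fun j => F (S j))) by (trivial; intros j; apply HF).
    rewrite (HG (S k) t Ht); ring.
Qed.

Fixpoint taylor_sum (rho : R) (F : nat -> C -> C) (k : nat) : R :=
  match k with
  | O => 0
  | S k' => Cmod (F O 0) + rho * taylor_sum rho (fun j => F (S j)) k'
  end.

(** The l1-norm of the Taylor coefficients acts on the sup-norms of the
    difference quotients; in contrast to the latter it is submultiplicative,
    which is what the iteration of the recurrence requires. *)
Definition dominated (rho : R) (F : nat -> C -> C) (A : R) : Prop :=
  forall k t, Cmod t < rho -> taylor_sum rho F k + Cmod (F k t) * rho ^ k <= A.

Lemma product_bounded (rho : R) (F G : nat -> C -> C) (A B : R) :
  0 < rho -> dominated rho F A -> bounded_on rho G B ->
  bounded_on rho (product F G) (A * B).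
Proof.
  intros Hr HF HG k t Ht.
  assert (PB := bounded_on_nonneg rho G B Hr HG).
  apply Rle_trans with ((taylor_sum rho F k + Cmod (F k t) * rho ^ k) * B);
    [|apply Rmult_le_compat_r; auto].
  clear HF; revert F; induction k as [|k IH]; intros F.
  - specialize (HG 0%nat t Ht); simpl in *; rewrite Cmod_mult.
    assert (X := Rmult_le_compat_l _ _ _ (Cmod_ge_0 (F 0%nat t)) HG); lra.
  - specialize (IH (fun j => F (S j))); specialize (HG (S k) t Ht).
    assert (X := Rmult_le_compat_l _ _ _ (Cmod_ge_0 (F 0%nat 0%C)) HG).
    assert (Y := Rmult_le_compat_l _ _ _ (Rlt_le _ _ Hr) IH).
    assert (P : 0 <= rho ^ S k) by (apply pow_le; lra).
    change (product F G (S k) t)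
      with (F 0%nat 0 * G (S k) t + product (fun j => F (S j)) G k t)%C.
    eapply Rle_trans;
      [apply Rmult_le_compat_r; [exact P|apply Cmod_triangle]|].
    rewrite Cmod_mult; simpl in *; lra.
Qed.

Lemma taylor_sum_le (rho rho' : R) (F : nat -> C -> C) (B : R) (k : nat) :
  0 < rho < rho' -> (forall j, Cmod (F j 0%C) * rho' ^ j <= B) ->
  taylor_sum rho F k <= B * (rho' / (rho' - rho)).
Proof.
  intros Hr; revert F B; induction k as [|k IH]; intros F B HB.
  - assert (H0 := HB 0%nat); simpl in *.
    assert (X := Cmod_ge_0 (F 0%nat 0%C)).
    apply Rmult_le_pos; [lra|]; apply Rdiv_le_0_compat; lra.
  - assert (H0 := HB 0%nat); simpl in H0.
    specialize (IH (fun j => F (S j)) (B / rho')).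
    assert (Hp : forall j, Cmod (F (S j) 0%C) * rho' ^ j <= B / rho').
    { intros j; apply Rmult_le_reg_r with rho'; [lra|].
      specialize (HB (S j)); simpl in HB; unfold Rdiv.
      rewrite (Rmult_assoc B), Rinv_l by lra; lra. }
    specialize (IH Hp).
    apply Rmult_le_compat_l with (r := rho) in IH; [|lra].
    replace (B * (rho' / (rho' - rho)))
      with (B + rho * (B / rho' * (rho' / (rho' - rho)))) by (field; lra).
    simpl; lra.
Qed.

Lemma expansion_dominated (f : C -> C) F (rho : R) :
  expansion f F -> 0 < rho < 1 -> exists A, 0 <= A /\ dominated rho F A.
Proof.
  intros (_ & _ & FB) Hr.
  set (rho' := (1 + rho) / 2).
  assert (Hr' : rho < rho' < 1) by (unfold rho'; lra).
  destruct (FB rho') as [B HB]; [lra|].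
  assert (PB := bounded_on_nonneg rho' F B ltac:(lra) HB).
  assert (PQ : 0 <= rho' / (rho' - rho)) by (apply Rdiv_le_0_compat; lra).
  exists (B * (rho' / (rho' - rho)) + B); split.
  - assert (0 <= B * (rho' / (rho' - rho))) by (apply Rmult_le_pos; trivial); lra.
  - intros k t Ht; apply Rplus_le_compat.
    + apply taylor_sum_le; [lra|].
      intros j; apply HB; rewrite Cmod_0; lra.
    + eapply Rle_trans; [|apply (HB k t); lra].
      apply Rmult_le_compat_l; [apply Cmod_ge_0|].
      apply pow_incr; lra.
Qed.

Lemma analytic_mult (f g : C -> C) :
  analytic f -> analytic g -> analytic (fun t => f t * g t)%C.
Proof.
  intros (F & HF) (G & G0 & GQ & GB); exists (product F G); split; [|split].
  - intros t Ht; simpl; rewrite (proj1 HF), G0; trivial.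
  - apply product_quotients; trivial; apply HF.
  - intros rho Hr; destruct (expansion_dominated f F rho HF Hr) as (A & _ & HA).
    destruct (GB rho Hr) as [B HB].
    exists (A * B); apply product_bounded; trivial; lra.
Qed.

Lemma Cmod_one_minus (s t : C) : Cmod s = 1 -> 1 - Cmod t <= Cmod (1 - s * t)%C.
Proof.
  intros Hs.
  assert (X := Cmod_triangle (1 - s * t)%C (s * t)%C).
  replace (1 - s * t + s * t)%C with (RtoC 1) in X by ring.
  rewrite Cmod_1, (Cmod_mult s), Hs in X; lra.
Qed.

(** For k > 0 the k-th difference quotient of (1 + s t) / (1 - s t) is
    2 s^k / (1 - s t). *)
Lemma analytic_moebius (s : C) :
  Cmod s = 1 -> analytic (fun t => (1 + s * t) / (1 - s * t))%C.
Proof.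
  intros Hs.
  assert (nz : forall t, Cmod t < 1 -> (1 - s * t)%C <> 0%C).
  { intros t Ht E; assert (X := Cmod_one_minus s t Hs).
    rewrite E, Cmod_0 in X; lra. }
  exists (fun k t => match k with
            | O => (1 + s * t) / (1 - s * t)
            | S _ => 2 * s ^ k / (1 - s * t) end)%C.
  split; [|split]; trivial.
  - assert (n1 : (1 - s * 0)%C <> 0%C) by (apply nz; rewrite Cmod_0; lra).
    assert (E0 : (1 - s * 0)%C = 1%C) by ring.
    intros [|k] t Ht; specialize (nz t Ht); rewrite E0; simpl.
    + field; repeat split; trivial; apply C1_nz.
    + field; repeat split; trivial; apply C1_nz.
  - intros rho Hr; exists (2 / (1 - rho)); intros k t Ht.
    assert (X := Cmod_one_minus s t Hs).
    assert (Hd : / Cmod (1 - s * t)%C <= / (1 - rho))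
      by (apply Rinv_le_contravar; lra).
    assert (Hp : rho ^ k <= 1) by (rewrite <- (pow1 k); apply pow_incr; lra).
    assert (Hp0 : 0 <= rho ^ k) by (apply pow_le; lra).
    assert (Hi : 0 < / Cmod (1 - s * t)%C) by (apply Rinv_0_lt_compat; lra).
    assert (K : forall z, Cmod z <= 2 ->
      Cmod (z / (1 - s * t))%C * rho ^ k <= 2 / (1 - rho)).
    { intros z Hz; rewrite Cmod_div by (apply nz; lra).
      assert (N := Cmod_ge_0 z).
      rewrite <- (Rmult_1_r (2 / (1 - rho))); unfold Rdiv.
      repeat apply Rmult_le_compat; try lra.
      apply Rmult_le_pos; lra. }
    destruct k as [|k]; apply K.
    + eapply Rle_trans; [apply Cmod_triangle|].
      rewrite Cmod_1, Cmod_mult, Hs; lra.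
    + rewrite Cmod_mult, Cmod_pow, Hs, pow1, Cmod_R, Rabs_pos_eq; lra.
Qed.

(** * Analytic dependence of the solutions on a parameter *)

(** The recurrence for the x_n is lifted to their difference quotients in t.  For
    each radius these grow at most geometrically in n, so that the sums against
    1 / n! converge and satisfy Cauchy's estimates again. *)
Lemma analytic_jet (a b c : C -> C) (y : nat -> C -> C) (j : nat) :
  analytic a -> analytic b -> analytic c ->
  (forall i, (i < 4)%nat -> analytic (y i)) ->
  analytic (fun t => jet (a t) (b t) (c t) (fun i => y i t) j 1).
Proof.
  intros (A & HA) (B & HB) (D & HD) Hy.
  assert (HY : exists Y : nat -> nat -> C -> C,
             forall i, (i < 4)%nat -> expansion (y i) (Y i)).
  { destruct (Hy 0%nat ltac:(lia)) as [Y0 E0], (Hy 1%nat ltac:(lia)) as [Y1 E1],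
      (Hy 2%nat ltac:(lia)) as [Y2 E2], (Hy 3%nat ltac:(lia)) as [Y3 E3].
    exists (fun i => match i with 0 => Y0 | 1 => Y1 | 2 => Y2 | _ => Y3 end%nat).
    intros [|[|[|[|i]]]] Hi; trivial; lia. }
  destruct HY as [Y HY].
  set (nextS := fun X2 X1 X0 : nat -> C -> C => fun k t =>
         (- (product A X2 k t + product B X1 k t + product D X0 k t))%C).
  set (X := linrec nextS Y).
  assert (Xval : forall n t, Cmod t < 1 ->
    X n 0%nat t = linrec (next_coef (a t) (b t) (c t)) (fun i => y i t) n).
  { intros n t Ht; induction n as [n IH] using lt_wf_ind.
    destruct n as [|[|[|[|m]]]].
    1: exact (proj1 (HY 0%nat ltac:(lia)) t Ht).
    1: exact (proj1 (HY 1%nat ltac:(lia)) t Ht).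
    1: exact (proj1 (HY 2%nat ltac:(lia)) t Ht).
    1: exact (proj1 (HY 3%nat ltac:(lia)) t Ht).
    change (nextS (X (S (S m))) (X (S m)) (X m) 0%nat t
      = next_coef (a t) (b t) (c t)
        (linrec (next_coef (a t) (b t) (c t)) (fun i => y i t) (S (S m)))
        (linrec (next_coef (a t) (b t) (c t)) (fun i => y i t) (S m))
        (linrec (next_coef (a t) (b t) (c t)) (fun i => y i t) m)).
    rewrite <- !IH by lia; unfold nextS, next_coef; simpl.
    rewrite (proj1 HA), (proj1 HB), (proj1 HD); trivial. }
  assert (Xbound : forall rho, 0 < rho < 1 -> exists K V, 0 <= K /\ 0 <= V /\
    forall n, quotients (X n) /\ bounded_on rho (X n) (V * K ^ n)).
  { intros rho Hr.
    destruct (expansion_dominated a A rho HA Hr) as (Na & Pa & Ma).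
    destruct (expansion_dominated b B rho HB Hr) as (Nb & Pb & Mb).
    destruct (expansion_dominated c D rho HD Hr) as (Nc & Pc & Mc).
    assert (HV : exists V, forall i, (i < 4)%nat -> bounded_on rho (Y i) V).
    { destruct (proj2 (proj2 (HY 0%nat ltac:(lia))) rho Hr) as [V0 H0].
      destruct (proj2 (proj2 (HY 1%nat ltac:(lia))) rho Hr) as [V1 H1].
      destruct (proj2 (proj2 (HY 2%nat ltac:(lia))) rho Hr) as [V2 H2].
      destruct (proj2 (proj2 (HY 3%nat ltac:(lia))) rho Hr) as [V3 H3].
      assert (P0 := bounded_on_nonneg _ _ _ (proj1 Hr) H0).
      assert (P1 := bounded_on_nonneg _ _ _ (proj1 Hr) H1).
      assert (P2 := bounded_on_nonneg _ _ _ (proj1 Hr) H2).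
      assert (P3 := bounded_on_nonneg _ _ _ (proj1 Hr) H3).
      exists (V0 + V1 + V2 + V3).
      intros [|[|[|[|i]]]] Hi; try lia; intros k t Ht;
        [specialize (H0 k t Ht)|specialize (H1 k t Ht)
        |specialize (H2 k t Ht)|specialize (H3 k t Ht)]; lra. }
    destruct HV as [V HV].
    assert (PV := bounded_on_nonneg _ _ _ (proj1 Hr) (HV 0%nat ltac:(lia))).
    exists (1 + Na + Nb + Nc), V; split; [lra|]; split; trivial.
    apply (linrec_bound (fun F M => quotients F /\ bounded_on rho F M)); trivial.
    - lra.
    - intros F M M' [HQ HM] Hle; split; trivial; intros k t Ht.
      eapply Rle_trans; [apply HM|]; trivial.
    - intros X2 X1 X0 M PM [Q2 M2] [Q1 M1] [Q0 M0]; split.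
      + intros k t Ht; unfold nextS.
        rewrite (product_quotients A X2 ltac:(apply HA) Q2 k t Ht),
          (product_quotients B X1 ltac:(apply HB) Q1 k t Ht),
          (product_quotients D X0 ltac:(apply HD) Q0 k t Ht); ring.
      + intros k t Ht; unfold nextS.
        assert (L2 := product_bounded rho A X2 Na M (proj1 Hr) Ma M2 k t Ht).
        assert (L1 := product_bounded rho B X1 Nb M (proj1 Hr) Mb M1 k t Ht).
        assert (L0 := product_bounded rho D X0 Nc M (proj1 Hr) Mc M0 k t Ht).
        assert (Pk : 0 <= rho ^ k) by (apply pow_le; lra).
        rewrite Cmod_opp.
        assert (T := Cmod_triangle (product A X2 k t + product B X1 k t)%C (product D X0 k t)).
        assert (T' := Cmod_triangle (product A X2 k t) (product B X1 k t)).
        eapply Rle_trans; [apply Rmult_le_compat_r; [trivial|];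
          eapply Rle_trans; [exact T|apply Rplus_le_compat_r; exact T']|].
        lra.
    - intros i Hi; split; [apply HY|apply HV]; trivial. }
  assert (Xgrowth : forall rho, 0 < rho < 1 -> exists K V, 0 <= K /\
    forall k t, Cmod t < rho -> growth (fun n => X (j + n)%nat k t) (V / rho ^ k) K).
  { intros rho Hr; destruct (Xbound rho Hr) as (K & V & PK & PV & H).
    exists K, (V * K ^ j); split; trivial; intros k t Ht n.
    destruct (H (j + n)%nat) as [_ HM]; specialize (HM k t Ht).
    assert (Pk : 0 < rho ^ k) by (apply pow_lt; lra).
    apply Rmult_le_reg_r with (rho ^ k); trivial.
    replace (V * K ^ j / rho ^ k * K ^ n * rho ^ k) with (V * K ^ (j + n))
      by (rewrite pow_add; field; lra).
    exact HM. }
  exists (fun k t => egf (fun n => X (j + n)%nat k t) 1); split; [|split].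
  - intros t Ht; unfold jet; apply egf_ext; intros n; apply Xval; trivial.
  - intros k t Ht.
    set (rho := (1 + Cmod t) / 2).
    assert (P := Cmod_ge_0 t).
    assert (Hr : 0 < rho < 1) by (unfold rho; lra).
    assert (Hlt : Cmod t < rho) by (unfold rho; lra).
    destruct (Xbound rho Hr) as (K0 & V0 & _ & _ & HQ).
    destruct (Xgrowth rho Hr) as (K & V & PK & HG).
    assert (G0 := HG k 0%C ltac:(rewrite Cmod_0; lra)).
    assert (G1 := HG (S k) t Hlt).
    transitivity (egf (fun n => 1 * X (j + n)%nat k 0
                                + t * X (j + n)%nat (S k) t)%C 1).
    + apply egf_ext; intros n.
      destruct (HQ (j + n)%nat) as [Q _]; rewrite (Q k t Ht); ring.
    + rewrite (egf_lin _ _ _ K _ K 1%C t 1 G0 PK G1 PK); ring.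
  - intros rho Hr; destruct (Xgrowth rho Hr) as (K & V & PK & HG).
    exists (2 * (V * exp K)); intros k t Ht.
    assert (Pk : 0 < rho ^ k) by (apply pow_lt; lra).
    assert (L := Cmod_egf_le _ _ _ (HG k t Ht) PK).
    apply Rmult_le_compat_r with (r := rho ^ k) in L; [|lra].
    replace (2 * (V / rho ^ k * exp K) * rho ^ k) with (2 * (V * exp K)) in L
      by (field; lra).
    exact L.
Qed.

(** * The characteristic determinant *)

Definition vec4 (z0 z1 z2 z3 : C) (j : nat) : C :=
  match j with 0 => z0 | 1 => z1 | 2 => z2 | _ => z3 end%nat.

Definition dot4 (r y : nat -> C) : C :=
  (r 0%nat * y 0%nat + r 1%nat * y 1%nat + r 2%nat * y 2%nat + r 3%nat * y 3%nat)%C.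

(** left1 and left2 span the jets (w, w', w'', w''')(0) satisfying the
    conditions at 0; right1 and right2 are the functionals of the jet at 1 that the
    conditions at 1 annihilate. *)
Definition left1 (b : boundary) (lambda : C) : nat -> C :=
  match b with
  | Elastic k => vec4 1 0 0 (- (k03 k + lambda * k04 k))
  | Clamped => vec4 0 0 1 0
  end%C.

Definition left2 (b : boundary) (lambda : C) : nat -> C :=
  match b with
  | Elastic k => vec4 0 1 (k01 k + lambda * k02 k) 0
  | Clamped => vec4 0 0 0 1
  end%C.

Definition right1 (b : boundary) (lambda : C) : nat -> C :=
  match b with
  | Elastic k => vec4 0 (k11 k + lambda * k12 k) 1 0
  | Clamped => vec4 1 0 0 0
  end%C.

Definition right2 (b : boundary) (lambda : C) : nat -> C :=
  match b with
  | Elastic k => vec4 (- (k13 k + lambda * k14 k)) 0 0 1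
  | Clamped => vec4 0 1 0 0
  end%C.

Lemma Cminus_eq_0 (x y : C) : (x - y)%C = 0%C <-> x = y.
Proof.
  split; [|intros ->; ring].
  intros H; replace x with (x - y + y)%C by ring; rewrite H; ring.
Qed.

Lemma boundary_conditions_jets (b : boundary) (lambda : C) (w w1 w2 w3 : R -> C) :
  boundary_conditions b lambda w w1 w2 w3 <->
  (exists p q : C, forall j, (j < 4)%nat ->
     vec4 (w 0) (w1 0) (w2 0) (w3 0) j
     = (p * left1 b lambda j + q * left2 b lambda j)%C) /\
  dot4 (right1 b lambda) (vec4 (w 1) (w1 1) (w2 1) (w3 1)) = 0%C /\
  dot4 (right2 b lambda) (vec4 (w 1) (w1 1) (w2 1) (w3 1)) = 0%C.
Proof.
  destruct b as [k|]; unfold dot4; simpl; split.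
  - intros (E1 & E2 & E3 & E4); split; [|split].
    + exists (w 0), (w1 0); intros [|[|[|[|j]]]] Hj; simpl; try ring; try lia.
      * apply Cminus_eq_0; etransitivity; [|exact E1]; ring.
      * apply Cminus_eq_0; etransitivity; [|exact E2]; ring.
    + etransitivity; [|exact E3]; ring.
    + etransitivity; [|exact E4]; ring.
  - intros ((p & q & H) & E3 & E4).
    assert (H0 := H 0%nat ltac:(lia)); assert (H1 := H 1%nat ltac:(lia)).
    assert (H2 := H 2%nat ltac:(lia)); assert (H3 := H 3%nat ltac:(lia)).
    simpl in *; rewrite H0, H1, H2, H3; split; [|split; [|split]].
    + ring.
    + ring.
    + etransitivity; [|exact E3]; ring.
    + etransitivity; [|exact E4]; ring.
  - intros (-> & -> & -> & ->); split; [|split].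
    + exists (w2 0), (w3 0); intros [|[|[|[|j]]]] Hj; simpl; try ring; lia.
    + ring.
    + ring.
  - intros ((p & q & H) & E3 & E4).
    assert (H0 := H 0%nat ltac:(lia)); assert (H1 := H 1%nat ltac:(lia)).
    simpl in *; rewrite H0, H1; split; [|split; [|split]].
    + ring.
    + ring.
    + etransitivity; [|exact E3]; ring.
    + etransitivity; [|exact E4]; ring.
Qed.

Lemma left_independent (b : boundary) (lambda p q : C) :
  (forall j, (j < 4)%nat -> (p * left1 b lambda j + q * left2 b lambda j)%C = 0%C) ->
  p = 0%C /\ q = 0%C.
Proof.
  intros H.
  assert (H0 := H 0%nat ltac:(lia)); assert (H1 := H 1%nat ltac:(lia)).
  assert (H2 := H 2%nat ltac:(lia)); assert (H3 := H 3%nat ltac:(lia)).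
  destruct b as [k|]; simpl in *.
  - split; [etransitivity; [|exact H0]; ring|etransitivity; [|exact H1]; ring].
  - split; [etransitivity; [|exact H2]; ring|etransitivity; [|exact H3]; ring].
Qed.

(** Each point of [0,1] has a neighbour in [0,1] at any distance up to 1/2, which
    determines the derivative, also at the endpoints. *)
Lemma derivative01_of_zero (f f' : R -> C) :
  derivative01 f f' -> (forall s, unit_interval s -> f s = 0%C) ->
  forall s, unit_interval s -> f' s = 0%C.
Proof.
  intros D Z s Hs; apply Cmod_eq_0, Rle_antisym; [|apply Cmod_ge_0].
  apply le_epsilon; intros eps He; rewrite Rplus_0_l.
  destruct (proj1 (is_derive01_eps f s _ Hs) (D s Hs) eps He) as (d & Hd & H).
  set (h := Rmin (d / 2) (/ 2)).
  assert (Ph : 0 < h) by (apply Rmin_pos; lra).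
  assert (L1 : h <= d / 2) by apply Rmin_l.
  assert (L2 : h <= / 2) by apply Rmin_r.
  assert (Hy : exists y, unit_interval y /\ Rabs (y - s) = h).
  { destruct Hs; destruct (Rle_dec s (/ 2)).
    - exists (s + h); split; [split; lra|].
      rewrite Rabs_pos_eq; lra.
    - exists (s - h); split; [split; lra|].
      rewrite Rabs_left; lra. }
  destruct Hy as (y & Hy & Ey); specialize (H y Hy ltac:(lra)).
  rewrite (Z y Hy), (Z s Hs) in H.
  replace (0 - 0 - RtoC (y - s) * f' s)%C with (- (RtoC (y - s) * f' s))%C in H by ring.
  rewrite Cmod_opp, Cmod_mult, Cmod_R, Ey in H.
  apply Rmult_le_reg_l with h; lra.
Qed.

Lemma singular_2x2 (d11 d12 d21 d22 : C) :
  (d11 * d22 - d12 * d21)%C = 0%C ->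
  exists p q : C, ~ (p = 0%C /\ q = 0%C) /\
    (p * d11 + q * d12)%C = 0%C /\ (p * d21 + q * d22)%C = 0%C.
Proof.
  intros H.
  destruct (classic (d11 = 0%C /\ d12 = 0%C)) as [[E1 E2]|N1].
  - destruct (classic (d21 = 0%C /\ d22 = 0%C)) as [[E3 E4]|N2].
    + exists 1%C, 0%C; split; [intros [E _]; exact (C1_nz E)|].
      rewrite E1, E2, E3, E4; split; ring.
    + exists (- d22)%C, d21; split; [|split; [rewrite E1, E2; ring|ring]].
      intros [E4 E3]; apply N2; split; trivial.
      replace d22 with (- - d22)%C by ring; rewrite E4; ring.
  - exists (- d12)%C, d11; split; [|split; [ring|rewrite <- H; ring]].
    intros [E2 E1]; apply N1; split; trivial.
    replace d12 with (- - d12)%C by ring; rewrite E2; ring.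
Qed.

(** The coefficients of the equation divided by 1 + alpha lambda. *)
Definition coef_a (alpha eta : R) (lambda : C) : C := (eta / (1 + alpha * lambda))%C.
Definition coef_b (alpha eta beta : R) (lambda : C) : C :=
  (2 * lambda * beta * sqrt eta / (1 + alpha * lambda))%C.
Definition coef_c (alpha delta : R) (lambda : C) : C :=
  ((delta * lambda + lambda * lambda) / (1 + alpha * lambda))%C.

Definition end_jet (alpha eta beta delta : R) (lambda : C) (y : nat -> C) (j : nat) : C :=
  jet (coef_a alpha eta lambda) (coef_b alpha eta beta lambda)
    (coef_c alpha delta lambda) y j 1.

(** The determinant of the two conditions at 1 on the solutions with initial jets left1
    and left2. *)
Definition char_det (alpha eta beta delta : R) (b : boundary) (lambda : C) : C :=
  let J := end_jet alpha eta beta delta lambda in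
  (dot4 (right1 b lambda) (J (left1 b lambda))
   * dot4 (right2 b lambda) (J (left2 b lambda))
   - dot4 (right1 b lambda) (J (left2 b lambda))
     * dot4 (right2 b lambda) (J (left1 b lambda)))%C.

Lemma mu_neq_0 (alpha : R) (lambda : C) :
  0 < alpha -> (lambda <> RtoC (- 1 / alpha) <-> (1 + alpha * lambda)%C <> 0%C).
Proof.
  intros Ha; split; intros H E; apply H.
  - replace lambda with ((1 + alpha * lambda - 1) * RtoC (/ alpha))%C.
    + rewrite E; replace (-1 / alpha) with (- / alpha) by (field; lra).
      rewrite RtoC_opp; ring.
    + replace ((1 + alpha * lambda - 1) * RtoC (/ alpha))%C
        with (RtoC alpha * RtoC (/ alpha) * lambda)%C by ring.
      rewrite <- RtoC_mult, Rinv_r by lra; ring.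
  - rewrite E, <- RtoC_mult.
    replace (alpha * (-1 / alpha)) with (- (1)) by (field; lra).
    rewrite RtoC_opp; ring.
Qed.

Lemma dot4_lin (r y y' : nat -> C) (p q : C) :
  dot4 r (fun j => p * y j + q * y' j)%C = (p * dot4 r y + q * dot4 r y')%C.
Proof. unfold dot4; ring. Qed.

(** The solutions satisfying the conditions at 0 form a plane; the determinant is
    that of the two remaining conditions restricted to this plane. *)
Lemma eigenvalue_char_det (alpha eta beta delta : R) (b : boundary) (lambda : C) :
  0 < alpha -> lambda <> RtoC (- 1 / alpha) ->
  (is_eigenvalue alpha eta beta delta b lambda <->
   char_det alpha eta beta delta b lambda = 0%C).
Proof.
  intros Ha Hl; assert (Hm := proj1 (mu_neq_0 alpha lambda Ha) Hl).
  unfold char_det, end_jet.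
  set (a := coef_a alpha eta lambda).
  set (b' := coef_b alpha eta beta lambda).
  set (c := coef_c alpha delta lambda).
  assert (EqN : forall x4 x2 x1 x0 : C,
    ((1 + alpha * lambda) * x4 + eta * x2 + 2 * lambda * beta * sqrt eta * x1
     + (delta * lambda + lambda * lambda) * x0)%C
    = ((1 + alpha * lambda) * (x4 - next_coef a b' c x2 x1 x0))%C).
  { intros x4 x2 x1 x0; unfold next_coef, a, b', c, coef_a, coef_b, coef_c.
    field; exact Hm. }
  set (l1 := left1 b lambda); set (l2 := left2 b lambda).
  set (r1 := right1 b lambda); set (r2 := right2 b lambda).
  assert (Jlin : forall r p q,
    dot4 r (fun j => jet a b' c (fun i => p * l1 i + q * l2 i)%C j 1)
    = (p * dot4 r (fun j => jet a b' c l1 j 1)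
       + q * dot4 r (fun j => jet a b' c l2 j 1))%C).
  { intros r p q; rewrite <- dot4_lin; unfold dot4; rewrite !jet_lin; reflexivity. }
  set (d11 := dot4 r1 (fun j => jet a b' c l1 j 1)) in *.
  set (d12 := dot4 r1 (fun j => jet a b' c l2 j 1)) in *.
  set (d21 := dot4 r2 (fun j => jet a b' c l1 j 1)) in *.
  set (d22 := dot4 r2 (fun j => jet a b' c l2 j 1)) in *.
  assert (U0 : unit_interval 0) by (split; lra).
  assert (U1 : unit_interval 1) by (split; lra).
  split.
  - intros (_ & w & (w1 & w2 & w3 & w4 & D0 & D1 & D2 & D3 & Eq & HB) & s & Hs & Hw).
    apply boundary_conditions_jets in HB; destruct HB as ((p & q & HL) & R1 & R2).
    assert (Un := cauchy_problem_unique a b' c w w1 w2 w3 w4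
      (fun i => p * l1 i + q * l2 i)%C D0 D1 D2 D3).
    assert (Un' : forall s, unit_interval s ->
      w s = jet a b' c (fun i => p * l1 i + q * l2 i)%C 0 s /\
      w1 s = jet a b' c (fun i => p * l1 i + q * l2 i)%C 1 s /\
      w2 s = jet a b' c (fun i => p * l1 i + q * l2 i)%C 2 s /\
      w3 s = jet a b' c (fun i => p * l1 i + q * l2 i)%C 3 s).
    { apply Un.
      - intros t Ht; specialize (Eq t Ht); rewrite EqN in Eq.
        apply Cminus_eq_0.
        destruct (Ceq_dec (w4 t - next_coef a b' c (w2 t) (w1 t) (w t))%C 0%C) as [E|E];
          trivial.
        exfalso; exact (Cmult_neq_0 _ _ Hm E Eq).
      - exact (HL 0%nat ltac:(lia)).
      - exact (HL 1%nat ltac:(lia)).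
      - exact (HL 2%nat ltac:(lia)).
      - exact (HL 3%nat ltac:(lia)). }
    clear Un.
    destruct (Un' 1 U1) as (V0 & V1 & V2 & V3).
    assert (S1 : (p * d11 + q * d12)%C = 0%C).
    { unfold d11, d12; rewrite <- (Jlin r1), <- R1.
      unfold dot4; simpl; rewrite V0, V1, V2, V3; reflexivity. }
    assert (S2 : (p * d21 + q * d22)%C = 0%C).
    { unfold d21, d22; rewrite <- (Jlin r2), <- R2.
      unfold dot4; simpl; rewrite V0, V1, V2, V3; reflexivity. }
    destruct (Ceq_dec (d11 * d22 - d12 * d21)%C 0%C) as [E|E]; trivial.
    exfalso; apply Hw; rewrite (proj1 (Un' s Hs)), jet_lin.
    assert (Ep : p = 0%C).
    { replace p with (((p * d11 + q * d12) * d22 - (p * d21 + q * d22) * d12)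
        / (d11 * d22 - d12 * d21))%C by (field; exact E).
      rewrite S1, S2; field; exact E. }
    assert (Eq' : q = 0%C).
    { replace q with (((p * d21 + q * d22) * d11 - (p * d11 + q * d12) * d21)
        / (d11 * d22 - d12 * d21))%C by (field; exact E).
      rewrite S1, S2; field; exact E. }
    rewrite Ep, Eq'; ring.
  - intros H; destruct (singular_2x2 _ _ _ _ H) as (p & q & N & S1 & S2).
    split; trivial.
    set (y := fun i => (p * l1 i + q * l2 i)%C).
    assert (D : forall j, derivative01 (jet a b' c y j) (jet a b' c y (S j)))
      by (intros j; apply jet_derive).
    exists (jet a b' c y 0); split.
    + exists (jet a b' c y 1), (jet a b' c y 2), (jet a b' c y 3), (jet a b' c y 4).
      do 4 (split; [apply D|]); split.
      * intros t Ht; rewrite EqN, jet_equation; ring.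
      * apply boundary_conditions_jets; split; [|split].
        -- exists p, q; intros j Hj.
           transitivity (jet a b' c y j 0); [|rewrite jet_initial; trivial].
           destruct j as [|[|[|[|j]]]]; trivial; lia.
        -- rewrite <- S1; unfold d11, d12; rewrite <- Jlin; reflexivity.
        -- rewrite <- S2; unfold d21, d22; rewrite <- Jlin; reflexivity.
    + apply NNPP; intros Hn.
      assert (Z0 : forall s, unit_interval s -> jet a b' c y 0 s = 0%C).
      { intros s Hs; apply NNPP; intros Hs'; apply Hn; exists s; split; trivial. }
      assert (Z1 := derivative01_of_zero _ _ (D 0%nat) Z0).
      assert (Z2 := derivative01_of_zero _ _ (D 1%nat) Z1).
      assert (Z3 := derivative01_of_zero _ _ (D 2%nat) Z2).
      apply N, (left_independent b lambda).
      intros j Hj; change (y j = 0%C); rewrite <- (jet_initial a b' c y j Hj).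
      destruct j as [|[|[|[|j]]]]; [apply Z0|apply Z1|apply Z2|apply Z3|lia]; trivial.
Qed.

Lemma analytic_dot4 (r y : nat -> C -> C) :
  (forall j, (j < 4)%nat -> analytic (r j)) ->
  (forall j, (j < 4)%nat -> analytic (y j)) ->
  analytic (fun t => dot4 (fun j => r j t) (fun j => y j t)).
Proof.
  intros Hr Hy; unfold dot4.
  repeat apply analytic_plus; apply analytic_mult; (apply Hr || apply Hy); lia.
Qed.

(** The boundary data are affine in lambda, and the coefficients of the equation are
    polynomials in lambda and 1 / (1 + alpha lambda). *)
Lemma analytic_char_det (alpha eta beta delta : R) (b : boundary) (lam : C -> C) :
  analytic lam -> analytic (fun t => / (1 + alpha * lam t))%C ->
  analytic (fun t => char_det alpha eta beta delta b (lam t)).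
Proof.
  intros Hl Hi.
  assert (opp : forall f, analytic f -> analytic (fun t => - f t)%C).
  { intros f Hf; apply analytic_ext with (fun t => - (1) * f t)%C.
    - intros t _; ring.
    - apply analytic_mult; [apply analytic_const|exact Hf]. }
  assert (Aa : analytic (fun t => coef_a alpha eta (lam t))).
  { unfold coef_a, Cdiv; apply analytic_mult; [apply analytic_const|exact Hi]. }
  assert (Ab : analytic (fun t => coef_b alpha eta beta (lam t))).
  { unfold coef_b, Cdiv.
    repeat apply analytic_mult; trivial; apply analytic_const. }
  assert (Ac : analytic (fun t => coef_c alpha delta (lam t))).
  { unfold coef_c, Cdiv; apply analytic_mult; [|exact Hi].
    apply analytic_plus; apply analytic_mult; trivial; apply analytic_const. }
  assert (aff : forall p q : R, analytic (fun t => p + lam t * q)%C).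
  { intros p q; apply analytic_plus; [apply analytic_const|].
    apply analytic_mult; [exact Hl|apply analytic_const]. }
  assert (L1 : forall j, (j < 4)%nat -> analytic (fun t => left1 b (lam t) j)).
  { destruct b as [k|]; intros [|[|[|[|j]]]] Hj; simpl; try lia;
      auto using analytic_const. }
  assert (L2 : forall j, (j < 4)%nat -> analytic (fun t => left2 b (lam t) j)).
  { destruct b as [k|]; intros [|[|[|[|j]]]] Hj; simpl; try lia;
      auto using analytic_const. }
  assert (R1 : forall j, (j < 4)%nat -> analytic (fun t => right1 b (lam t) j)).
  { destruct b as [k|]; intros [|[|[|[|j]]]] Hj; simpl; try lia;
      auto using analytic_const. }
  assert (R2 : forall j, (j < 4)%nat -> analytic (fun t => right2 b (lam t) j)).
  { destruct b as [k|]; intros [|[|[|[|j]]]] Hj; simpl; try lia;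
      auto using analytic_const. }
  assert (HJ : forall (r l : C -> nat -> C),
    (forall j, (j < 4)%nat -> analytic (fun t => r (lam t) j)) ->
    (forall j, (j < 4)%nat -> analytic (fun t => l (lam t) j)) ->
    analytic (fun t => dot4 (r (lam t))
      (end_jet alpha eta beta delta (lam t) (l (lam t))))).
  { intros r l Hr Hl'.
    apply (analytic_dot4 (fun j t => r (lam t) j)); trivial.
    intros j _; unfold end_jet.
    apply (analytic_jet _ _ _ (fun i t => l (lam t) i)); trivial. }
  unfold char_det.
  apply analytic_plus; [|apply opp]; apply analytic_mult; apply HJ; trivial.
Qed.

(** * The eigenvalues are isolated *)

Lemma Cmod_lt_of_sqr (z w : C) :
  Re z ^ 2 + Im z ^ 2 < Re w ^ 2 + Im w ^ 2 -> Cmod z < Cmod w.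
Proof.
  rewrite <- !Cmod2_alt; intros H.
  assert (X := Cmod_ge_0 z); assert (Y := Cmod_ge_0 w); nra.
Qed.

(** A half plane {Re (m / m1) > 0} contains points m of arbitrarily large modulus
    outside the left sector of half opening pi/4: one of the directions
    m1 (1 - 2 i) and m1 (1 + 2 i) avoids the sector. *)
Lemma half_plane_escapes_sector (alpha L : R) (m1 : C) :
  0 < alpha -> 0 < L -> m1 <> 0%C ->
  exists v : C, 0 < Re v /\
    let lambda := ((m1 * v - 1) * RtoC (/ alpha))%C in
    L < Cmod lambda /\ ~ (Re lambda < 0 /\ Rabs (Im lambda) <= - Re lambda).
Proof.
  intros Ha HL Hm; destruct m1 as [a b].
  assert (Hab : a <> 0 \/ b <> 0).
  { destruct (Req_dec a 0) as [E|]; [|auto]; destruct (Req_dec b 0) as [E'|]; [|auto].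
    exfalso; apply Hm; rewrite E, E'; reflexivity. }
  assert (Hc : exists c, 0 < Rabs (b - c * a) + (a + c * b)).
  { destruct (Rle_dec 0 b).
    - exists 2; assert (X := Rle_abs (b - 2 * a)); assert (Y := Rabs_pos (b - 2 * a)).
      destruct (Rlt_dec 0 a); [lra|]; destruct Hab; lra.
    - exists (-2); assert (X := Rle_abs (- (b - -2 * a))); rewrite Rabs_Ropp in X.
      assert (Y := Rabs_pos (b - -2 * a)).
      destruct (Rlt_dec 0 a); lra. }
  destruct Hc as [c Hc].
  set (k := Rabs (b - c * a) + (a + c * b)) in *.
  set (T := (2 * alpha * L + 2) / k).
  assert (PaL : 0 < alpha * L) by (apply Rmult_lt_0_compat; trivial).
  assert (PT : 0 < T) by (apply Rdiv_lt_0_compat; lra).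
  assert (HT : T * k = 2 * alpha * L + 2) by (unfold T; field; lra).
  exists (T, - (T * c)); split; [exact PT|]; intros lambda.
  assert (Pi : 0 < / alpha) by (apply Rinv_0_lt_compat; trivial).
  set (x := T * (a + c * b) - 1); set (y := T * (b - c * a)).
  assert (Ex : Re lambda = x * / alpha) by (unfold x; simpl; ring).
  assert (Ey : Im lambda = y * / alpha) by (unfold y; simpl; ring).
  assert (Hy : Rabs y + x = 2 * alpha * L + 1).
  { unfold x, y; rewrite Rabs_mult, (Rabs_pos_eq T) by lra.
    unfold k in HT; lra. }
  assert (Hxy : (Rabs y + x) * / alpha <= 2 * Cmod lambda).
  { assert (X := re_le_Cmod lambda); assert (Y := im_le_Cmod lambda).
    rewrite Ex in X; rewrite Ey, Rabs_mult, (Rabs_pos_eq (/ alpha)) in Y by lra.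
    assert (X' := Rle_abs (x * / alpha)); lra. }
  split.
  - rewrite Hy in Hxy.
    replace ((2 * alpha * L + 1) * / alpha) with (2 * L + / alpha) in Hxy
      by (field; lra).
    lra.
  - rewrite Ex, Ey, Rabs_mult, (Rabs_pos_eq (/ alpha)) by lra; intros [_ H].
    assert (0 < (Rabs y + x) * / alpha) by (apply Rmult_lt_0_compat; lra); lra.
Qed.

(** The map t -> m1 (1 + t) / (1 - t) sends the unit disc onto the half plane
    {Re (m / m1) > 0} and 0 to m1.  In this parameter, with
    m = 1 + alpha lambda, the characteristic determinant is analytic; it does not
    vanish identically since the half plane leaves the sector that contains the
    large eigenvalues. *)
Lemma eigenvalues_isolated (alpha eta beta delta : R) (b : boundary) (z : C) :
  0 < alpha -> 0 <= eta -> 0 < beta < 1 -> 0 <= delta -> admissible b ->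
  z <> RtoC (- 1 / alpha) ->
  ~ accumulation_point (is_eigenvalue alpha eta beta delta b) (FinC z).
Proof.
  intros Ha He Hb Hd Hadm Hz Hacc.
  set (m1 := (1 + alpha * z)%C).
  assert (Hm1 : m1 <> 0%C) by (apply mu_neq_0; trivial).
  assert (Pm1 : 0 < Cmod m1) by (apply Cmod_gt_0; exact Hm1).
  assert (Hac : RtoC alpha <> 0%C) by (intros E; apply RtoC_inj in E; lra).
  set (lam := fun t : C => ((m1 * ((1 + 1 * t) / (1 - 1 * t)) - 1) * RtoC (/ alpha))%C).
  assert (Emu : forall t, (1 + alpha * lam t)%C = (m1 * ((1 + 1 * t) / (1 - 1 * t)))%C).
  { intros t; unfold lam; rewrite RtoC_inv by lra; generalize ((1 + 1 * t) / (1 - 1 * t))%C.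
    intros u; field; exact Hac. }
  assert (nz : forall s t : C, Cmod s = 1 -> Cmod t < 1 -> (1 - s * t)%C <> 0%C).
  { intros s t Hs Ht E; assert (X := Cmod_one_minus s t Hs).
    rewrite E, Cmod_0 in X; lra. }
  assert (nz1 : forall t : C, Cmod t < 1 -> (1 - t)%C <> 0%C).
  { intros t Ht E; apply (nz 1%C t Cmod_1 Ht); rewrite <- E; ring. }
  assert (nz2 : forall t : C, Cmod t < 1 -> (1 + t)%C <> 0%C).
  { intros t Ht E; apply (nz (- (1))%C t Cmod_m1 Ht).
    transitivity (1 + t)%C; [ring|exact E]. }
  assert (Hdom : forall t, Cmod t < 1 -> lam t <> RtoC (- 1 / alpha)).
  { intros t Ht; apply mu_neq_0; trivial; rewrite Emu.
    apply Cmult_neq_0; [exact Hm1|]; intros E; apply (nz2 t Ht).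
    replace (1 + t)%C with ((1 + 1 * t) / (1 - 1 * t) * (1 - t))%C
      by (rewrite !Cmult_1_l; field; auto).
    rewrite E; ring. }
  assert (Alam : analytic lam).
  { unfold lam; apply analytic_mult; [|apply analytic_const].
    apply analytic_plus; [|apply analytic_const].
    apply analytic_mult; [apply analytic_const|apply analytic_moebius, Cmod_1]. }
  assert (Ainv : analytic (fun t => / (1 + alpha * lam t))%C).
  { apply analytic_ext
      with (fun t => / m1 * ((1 + - (1) * t) / (1 - - (1) * t)))%C.
    - intros t Ht; rewrite Emu.
      specialize (nz1 t Ht); specialize (nz2 t Ht).
      replace (1 + - (1) * t)%C with (1 - t)%C by ring.
      replace (1 - - (1) * t)%C with (1 + t)%C by ring.
      replace (1 + 1 * t)%C with (1 + t)%C by ring.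
      replace (1 - 1 * t)%C with (1 - t)%C by ring.
      field; auto.
    - apply analytic_mult; [apply analytic_const|apply analytic_moebius, Cmod_m1]. }
  assert (Zero := analytic_identity _
    (analytic_char_det alpha eta beta delta b lam Alam Ainv)).
  assert (Zacc : forall d, 0 < d -> exists t : C, t <> 0%C /\ Cmod t < d /\
            char_det alpha eta beta delta b (lam t) = 0%C).
  { intros d Pd.
    set (e := Cmod m1 * Rmin d 1 / alpha).
    assert (Pmin : 0 < Rmin d 1) by (apply Rmin_pos; lra).
    assert (Pe : 0 < e)
      by (apply Rdiv_lt_0_compat; trivial; apply Rmult_lt_0_compat; trivial).
    destruct (Hacc (fun p => match p with
                | FinC x => Cmod (x - z)%C < e | InfC => False end))
      as (l & Nl & El & Dl).
    { simpl; assert (Pe2 : 0 < e / 2) by lra.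
      exists (mkposreal _ Pe2); intros x [B1 B2].
      eapply Rle_lt_trans; [apply Cmod_le_Re_Im|].
      assert (B1' : Rabs (Re (x - z)%C) < e / 2) by exact B1.
      assert (B2' : Rabs (Im (x - z)%C) < e / 2) by exact B2.
      lra. }
    set (m := (1 + alpha * l)%C).
    assert (Em : (m - m1)%C = (alpha * (l - z))%C) by (unfold m, m1; ring).
    assert (Dm : Cmod (m - m1)%C < Cmod m1 * Rmin d 1).
    { rewrite Em, Cmod_mult, Cmod_R, Rabs_pos_eq by lra.
      apply Rmult_lt_compat_l with (r := alpha) in Dl; trivial.
      unfold e in Dl; replace (alpha * (Cmod m1 * Rmin d 1 / alpha))
        with (Cmod m1 * Rmin d 1) in Dl by (field; lra).
      exact Dl. }
    assert (Dm1 : Cmod (m - m1)%C < Cmod m1).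
    { eapply Rlt_le_trans; [exact Dm|].
      rewrite <- (Rmult_1_r (Cmod m1)) at 2; apply Rmult_le_compat_l;
        [lra|apply Rmin_r]. }
    assert (Lm : Cmod m1 <= Cmod (m + m1)%C).
    { assert (X := Cmod_triangle (m + m1)%C (- (m - m1))%C).
      replace (m + m1 + - (m - m1))%C with (2 * m1)%C in X by ring.
      rewrite Cmod_opp, Cmod_mult, Cmod_R, (Rabs_pos_eq 2) in X by lra; lra. }
    assert (Nm : (m + m1)%C <> 0%C) by (apply Cmod_gt_0; lra).
    assert (N2 : (2 * m1)%C <> 0%C).
    { apply Cmod_gt_0; rewrite Cmod_mult, Cmod_R, (Rabs_pos_eq 2) by lra; lra. }
    exists ((m - m1) / (m + m1))%C; split; [|split].
    - intros E; apply Nl; f_equal.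
      assert (E0 : (m - m1)%C = 0%C).
      { replace (m - m1)%C with ((m - m1) / (m + m1) * (m + m1))%C
          by (field; exact Nm).
        rewrite E; ring. }
      rewrite Em in E0; apply Cminus_eq_0.
      destruct (Ceq_dec (l - z)%C 0%C) as [|N]; trivial.
      exfalso; exact (Cmult_neq_0 _ _ Hac N E0).
    - rewrite Cmod_div by exact Nm.
      apply Rmult_lt_reg_r with (Cmod (m + m1)%C); [lra|].
      unfold Rdiv; rewrite Rmult_assoc, Rinv_l, Rmult_1_r by lra.
      eapply Rlt_le_trans; [exact Dm|].
      rewrite Rmult_comm; apply Rmult_le_compat; try lra; apply Rmin_l.
    - replace (lam ((m - m1) / (m + m1))%C) with l.
      + apply eigenvalue_char_det; trivial; exact (proj1 El).
      + unfold lam.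
        replace ((1 + 1 * ((m - m1) / (m + m1))) / (1 - 1 * ((m - m1) / (m + m1))))%C
          with (m / m1)%C.
        * rewrite RtoC_inv by lra; unfold m at 1; field; auto.
        * field; repeat split; trivial.
          replace (m + m1 - (m - m1))%C with (2 * m1)%C by ring; exact N2. }
  destruct (eigenvalue_sector alpha eta beta delta b Ha He Hb Hd Hadm)
    as (L & HL & Sector).
  destruct (half_plane_escapes_sector alpha L m1 Ha HL Hm1) as (v & Pv & Large & Out).
  assert (Nv : (v + 1)%C <> 0%C).
  { intros E; apply (f_equal Re) in E; destruct v; simpl in *; lra. }
  set (t0 := ((v - 1) / (v + 1))%C).
  assert (Ht0 : Cmod t0 < 1).
  { unfold t0; rewrite Cmod_div by exact Nv.
    assert (P : 0 < Cmod (v + 1)%C) by (apply Cmod_gt_0; exact Nv).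
    apply Rmult_lt_reg_r with (Cmod (v + 1)%C); trivial.
    unfold Rdiv; rewrite Rmult_assoc, Rinv_l, Rmult_1_r, Rmult_1_l by lra.
    apply Cmod_lt_of_sqr; destruct v as [v1 v2]; simpl in *; nra. }
  assert (Elam : lam t0 = ((m1 * v - 1) * RtoC (/ alpha))%C).
  { unfold lam.
    replace ((1 + 1 * t0) / (1 - 1 * t0))%C with v; trivial.
    unfold t0; field; split; trivial.
    replace (v + 1 - (v - 1))%C with (RtoC 2) by ring.
    intros E; apply RtoC_inj in E; lra. }
  apply Out; rewrite <- Elam in *.
  apply Sector; [|exact Large].
  apply eigenvalue_char_det; auto.
Qed.

Theorem mainTheorem4 (alpha : R) (Halpha : 0 < alpha) (kappa : option (R * R)) :
  exists r : R, 0 < r /\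
  forall (eta beta delta : R) (b : boundary),
    0 <= eta -> 0 < beta < 1 -> 0 <= delta ->
    admissible b -> k_04_14 b = kappa ->
    (forall lambda : nat -> C,
       (forall n, is_eigenvalue alpha eta beta delta b (lambda n)) ->
       is_lim_seq (fun n => Cmod (lambda n)) p_infty ->
       exists N : nat, forall n : nat, (N <= n)%nat ->
         Re (lambda n) <> 0 /\
         Rabs (Im (lambda n)) / Rabs (Re (lambda n)) <= 1) /\
    (exists z0 : R, 0 < z0 /\
       forall lambda : C, is_eigenvalue alpha eta beta delta b lambda ->
         sectorial_set alpha r z0 lambda) /\
    (forall p : extC,
       accumulation_point (is_eigenvalue alpha eta beta delta b) p ->
       p = FinC (RtoC (- 1 / alpha)) \/ p = InfC).
Proof.
  exists 1; split; [lra|].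
  intros eta beta delta b He Hb Hd Hadm _.
  destruct (eigenvalue_sector alpha eta beta delta b Halpha He Hb Hd Hadm)
    as (L & HL & Sector).
  split; [|split].
  - intros lambda Heig Hlim.
    destruct (Hlim (fun x => L < x)) as [N HN]; [exists L; trivial|].
    exists N; intros n Hn.
    destruct (Sector _ (Heig n) (HN n Hn)) as [Neg Le].
    split; [lra|].
    assert (P : 0 < Rabs (Re (lambda n))) by (apply Rabs_pos_lt; lra).
    apply Rmult_le_reg_r with (Rabs (Re (lambda n))); trivial.
    unfold Rdiv; rewrite Rmult_assoc, Rinv_l, (Rabs_left (Re (lambda n))) by lra.
    lra.
  - (* With the vertex at 2 L the disc of radius L lies in the sector, too. *)
    exists (2 * L); split; [lra|]; intros lambda Heig.
    split; [exact (proj1 Heig)|].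
    replace (Im (lambda - RtoC (2 * L)%R)%C) with (Im lambda)
      by (destruct lambda; simpl; ring).
    replace (Re (lambda - RtoC (2 * L)%R)%C) with (Re lambda - 2 * L)
      by (destruct lambda; simpl; ring).
    assert (K : Rabs (Im lambda) <= - (Re lambda - 2 * L)).
    { destruct (Rlt_dec L (Cmod lambda)) as [Far|Near].
      - destruct (Sector _ Heig Far); lra.
      - assert (X := im_le_Cmod lambda); assert (Y := re_le_Cmod lambda).
        assert (Z := Rle_abs (Re lambda)); lra. }
    assert (P := Rabs_pos (Im lambda)).
    rewrite (Rabs_left1 (Re lambda - 2 * L)); lra.
  - intros [z|] Hacc; [left|right; trivial].
    destruct (Ceq_dec z (RtoC (- 1 / alpha))) as [E|E]; [rewrite E; trivial|].
    exfalso; exact (eigenvalues_isolated _ _ _ _ _ _ Halpha He Hb Hd Hadm E Hacc).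
Qed.
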